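(* Let $S$ be a semisimple Lie algebra, $\mathfrak{m}$ a $d$-dimensional $S$-module given by the representation $\rho$, and $\mathcal{N}_{d,t}$ the free $t$-nilpotent Lie algebra generated by $\mathfrak{m}$. The $t$-nilpotent Lie algebras of type $d$ admitting $S$ as Levi extension are of the form $\mathcal{N}_{d,t}/I$, where $\mathcal{N}_{d,t}$ and the ideal $I$ are $S$-modules through the representation $\Delta\circ\rho$, and $$\mathcal{N}_{d,t}^{\,t}\not\subseteq I\subseteq \mathcal{N}_{d,t}^{\,2}.$$ In this case, $\mathcal{N}_{d,t}/I$ is regarded as a quotient $S$-module. Moreover, $\mathcal{N}_{d,t}/I$ is a faithful module if and only if $\mathfrak{m}$ also is.
   Context: All vector spaces and algebras (other than free Lie algebras) are finite-dimensional over a field $k$ of characteristic zero. For a Lie algebra $N$, the lower central series is $N^1=N$, $N^{j+1}=[N,N^j]$. $N$ is called $t$-nilpotent if $N^t\neq 0$ and $N^{t+1}=0$. The type of $N$ is $\dim N/N^2$. A semisimple Lie algebra $S$ is a Levi extension of a solvable Lie algebra $R$ if there is a representation $\sigma:S\to\mathfrak{gl}(R)$ with $\sigma(S)\subseteq \mathrm{Der}\,R$, the derivation algebra of $R$. Let $X=\{x_1,\dots,x_d\}$ be a basis of $\mathfrak{m}$ and let $\mathfrak{FL}$ be the free Lie algebra on $X$. The free $t$-nilpotent Lie algebra generated by $\mathfrak{m}$ is $\mathcal{N}_{d,t}=\mathfrak{FL}/\mathfrak{FL}^{t+1}$, where $\mathfrak{FL}^{t+1}$ is the ideal spanned by the homogeneous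 elements of degree at least $t+1$; $\mathfrak{m}$ is identified with its image in $\mathcal{N}_{d,t}$. Every linear map $\delta:\mathfrak{m}\to\mathcal{N}_{d,t}$ extends uniquely to a derivation $\widehat{\delta}$ of $\mathcal{N}_{d,t}$. The map $\Delta:\mathfrak{gl}(\mathfrak{m})\to\mathrm{Der}\,\mathcal{N}_{d,t}$, $\delta\mapsto\widehat{\delta}$, is an injective Lie algebra homomorphism. *)

(* Defs.v *)
From HB Require Import structures.
From mathcomp Require Import all_boot all_order all_algebra.
From mathcomp Require Import boolp.

Set Implicit Arguments.
Unset Strict Implicit.
Unset Printing Implicit Defensive.

Import GRing.Theory.

Local Open Scope ring_scope.
Local Open Scope quotient_scope.

HB.mixin Record Lmodule_isLie (k : fieldType) L of GRing.Lmodule k L := {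
  lie : L -> L -> L;
  lieDl : forall x y z, lie (x + y) z = lie x z + lie y z;
  lieDr : forall x y z, lie x (y + z) = lie x y + lie x z;
  lieZl : forall a x y, lie (a *: x) y = a *: lie x y;
  lieZr : forall a x y, lie x (a *: y) = a *: lie x y;
  liexx : forall x, lie x x = 0;
  lie_jacobi : forall x y z,
    lie x (lie y z) + lie y (lie z x) + lie z (lie x y) = 0 }.

#[short(type="lieType")]
HB.structure Definition Lie (k : fieldType) :=
  { L of GRing.Lmodule k L & Lmodule_isLie k L }.

#[short(type="vectLieType")]
HB.structure Definition VectLie (k : fieldType) :=
  { L of Vector k L & Lie k L }.

Section LieTheory.
Variables (k : fieldType) (L : lieType k).
Implicit Types x y : L.

Lemma lie0r x : lie x 0 = 0.
Proof. by rewrite -[0](scale0r 0) lieZr !scale0r. Qed.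

Lemma lie0l x : lie 0 x = 0.
Proof. by rewrite -[0](scale0r 0) lieZl !scale0r. Qed.

Lemma lieBl x y z : lie (x - y) z = lie x z - lie y z.
Proof. by rewrite -scaleN1r lieDl lieZl scaleN1r. Qed.

Lemma lieBr x y z : lie x (y - z) = lie x y - lie x z.
Proof. by rewrite -scaleN1r lieDr lieZr scaleN1r. Qed.

Lemma lieC x y : lie x y = - lie y x.
Proof.
apply/eqP; rewrite -addr_eq0; apply/eqP; have := liexx (x + y).
by rewrite lieDl !lieDr !liexx add0r addr0.
Qed.

Definition lie_ideal_closed (I : {pred L}) := forall x y, y \in I -> lie x y \in I.

End LieTheory.

HB.mixin Record isLieIdeal (k : fieldType) (L : lieType k) (I : L -> bool) := {
  lie_idealP : lie_ideal_closed I }.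

#[short(type="lieIdeal")]
HB.structure Definition LieIdeal (k : fieldType) (L : lieType k) :=
  { I of @GRing.SubmodClosed k L I & isLieIdeal k L I }.

Section FiniteSpan.
Variables (k : fieldType) (V : lmodType k).

Inductive lspan (s : seq V) : V -> Prop :=
| lspan_mem x : x \in s -> lspan s x
| lspan0 : lspan s 0
| lspanD x y : lspan s x -> lspan s y -> lspan s (x + y)
| lspanZ a x : lspan s x -> lspan s (a *: x).

Definition combines n (e : 'I_n -> V) :=
  forall x, exists c : 'I_n -> k, x = \sum_i c i *: e i.

Lemma lspan_combines s : (forall x, lspan s x) ->
  combines (fun i : 'I_(size s) => s`_i).
Proof.
move=> sV x; elim: {x}(sV x) => [x xs||x y _ [c ->] _ [c' ->]|a x _ [c ->]].
- have ltxs : (index x s < size s)%N by rewrite index_mem.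
  exists (fun i => (i == Ordinal ltxs)%:R).
  rewrite (bigD1 (Ordinal ltxs)) //= eqxx scale1r nth_index // big1 ?addr0 //.
  by move=> i /negPf->; rewrite scale0r.
- by exists (fun=> 0); rewrite big1 // => i _; rewrite scale0r.
- exists (fun i => c i + c' i); rewrite -big_split /=.
  by apply: eq_bigr => i _; rewrite scalerDl.
- exists (fun i => a * c i); rewrite scaler_sumr.
  by apply: eq_bigr => i _; rewrite scalerA.
Qed.

Lemma min_combines : (exists n (e : 'I_n -> V), combines e) ->
  exists n (e : 'I_n -> V), combines e /\
    forall c : 'I_n -> k, \sum_i c i *: e i = 0 -> forall i, c i = 0.
Proof.
move=> exV; pose P n := `[< exists e : 'I_n -> V, combines e >].
have exP : exists n, P n by case: exV => n H; exists n; apply/asboolP.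
case: (ex_minnP exP) => n /asboolP[e eV] min_n; exists n, e; split=> // c c0 j.
apply/eqP/negPn/negP => cj.
case: n => [|n] in e eV min_n c c0 j cj *; first by case: j {cj}.
suff /min_n : P n by rewrite ltnn.
apply/asboolP; exists (e \o lift j) => x; have [b ->] := eV x.
have ej : e j = \sum_(i < n) (- ((c j)^-1 * c (lift j i))) *: e (lift j i).
  have := c0; rewrite (bigD1_ord j) //= => /eqP.
  rewrite addr_eq0 => /eqP /(congr1 (fun v => (c j)^-1 *: v)).
  rewrite scalerA mulVf // scale1r => ->; rewrite scalerN scaler_sumr -sumrN.
  by apply: eq_bigr => i _; rewrite scalerA scaleNr.
exists (fun i => b (lift j i) - b j * ((c j)^-1 * c (lift j i))).
rewrite (bigD1_ord j) //= ej scaler_sumr -big_split /=.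
by apply: eq_bigr => i _; rewrite scalerA -scalerDl mulrN addrC.
Qed.

Lemma findim_axiom : (exists s : seq V, forall x, lspan s x) ->
  {n : nat & Vector.axiom n V}.
Proof.
move=> exs; have /cid[n /cid[e [eV eF]]] : exists n (e : 'I_n -> V), combines e /\
    forall c : 'I_n -> k, \sum_i c i *: e i = 0 -> forall i, c i = 0.
  by apply: min_combines; case: exs => s /lspan_combines H; exists (size s); eexists; exact: H.
pose co x := projT1 (cid (eV x)).
have coE x : x = \sum_i co x i *: e i by rewrite /co; case: cid.
have coU x c : x = \sum_i c i *: e i -> co x =1 c.
  move=> xE i; apply/eqP; rewrite -subr_eq0; apply/eqP.
  apply: (eF (fun i => co x i - c i)).
  under eq_bigr do rewrite scalerBl.
  by rewrite sumrB -coE -xE subrr.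
exists n; exists (fun x => \row_i co x i).
  move=> a x y; apply/rowP => i; rewrite !mxE; apply: (coU _ (fun i => a * co x i + co y i)).
  rewrite {1}[x]coE {1}[y]coE scaler_sumr -big_split /=.
  by apply: eq_bigr => j _; rewrite scalerA -scalerDl.
exists (fun r : 'rV_n => \sum_i r 0 i *: e i) => [x|r].
  by rewrite [RHS]coE; apply: eq_bigr => i _; rewrite mxE.
by apply/rowP => i; rewrite mxE; exact: (coU _ (fun i => r 0 i)).
Qed.

End FiniteSpan.

Section LinearQuotient.
Variables (k : fieldType) (V : lmodType k) (I : submodClosed V).

Fact submod_zmod_closed : zmod_closed I.
Proof. exact: GRing.submod_closedB (submodClosedP I). Qed.

Definition submod_zmod : zmodClosed V :=
  HB.pack_for (zmodClosed V) (GRing.SubmodClosed.sort I)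
    (GRing.isZmodClosed.Build V (GRing.SubmodClosed.sort I) submod_zmod_closed).

Definition lquot := Quotient.quot submod_zmod.
HB.instance Definition _ := GRing.Zmodule.on lquot.

Definition lquot_proj : V -> lquot := fun x => \pi_(Quotient.quot submod_zmod) x.
Definition lquot_repr : lquot -> V := fun x => repr (x : Quotient.quot submod_zmod).

Lemma lquot_reprK : cancel lquot_repr lquot_proj.
Proof. exact: reprK. Qed.

Lemma lquot_eq x y : lquot_proj x = lquot_proj y <-> x - y \in I.
Proof.
have -> : (x - y \in I) = (\pi_(Quotient.quot submod_zmod) x == \pi_(Quotient.quot submod_zmod) y).
  exact: (Quotient.idealrBE submod_zmod x y).
by split=> /eqP.
Qed.

Lemma lquot_projD x y : lquot_proj (x + y) = lquot_proj x + lquot_proj y.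
Proof. exact: raddfD. Qed.

Lemma lquot_proj0 : lquot_proj 0 = 0.
Proof. exact: raddf0. Qed.

Lemma lquot_eq0 x : lquot_proj x = 0 <-> x \in I.
Proof. by rewrite -lquot_proj0 lquot_eq subr0. Qed.

Definition lquot_scale (a : k) (x : lquot) : lquot := lquot_proj (a *: lquot_repr x).

Lemma lquot_projZ a x : lquot_proj (a *: x) = lquot_scale a (lquot_proj x).
Proof.
by apply/lquot_eq; rewrite -scalerBr rpredZ //; apply/lquot_eq; rewrite lquot_reprK.
Qed.

Fact lquot_scaleA a b x : lquot_scale a (lquot_scale b x) = lquot_scale (a * b) x.
Proof. by rewrite -[x]lquot_reprK -!lquot_projZ scalerA. Qed.
Fact lquot_scale1 : left_id 1 lquot_scale.
Proof. by move=> x; rewrite -[x]lquot_reprK -!lquot_projZ scale1r. Qed.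
Fact lquot_scaleDr : right_distributive lquot_scale +%R.
Proof.
move=> a x y; rewrite -[x]lquot_reprK -[y]lquot_reprK.
by rewrite -lquot_projD -!lquot_projZ -lquot_projD scalerDr.
Qed.
Fact lquot_scaleDl x : {morph lquot_scale^~ x : a b / a + b}.
Proof.
by move=> a b; rewrite -[x]lquot_reprK -!lquot_projZ -lquot_projD scalerDl.
Qed.

HB.instance Definition _ := GRing.Zmodule_isLmodule.Build k lquot
  lquot_scaleA lquot_scale1 lquot_scaleDr lquot_scaleDl.

Fact lquot_proj_linear : linear lquot_proj.
Proof. by move=> a x y; rewrite lquot_projD lquot_projZ. Qed.

HB.instance Definition _ := GRing.isLinear.Build k V lquot _ lquot_proj lquot_proj_linear.

End LinearQuotient.

Section VectorQuotient.
Variables (k : fieldType) (V : vectType k) (I : submodClosed V).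

Lemma lquot_findim : exists s : seq (lquot I), forall x, lspan s x.
Proof.
exists [seq lquot_proj I v | v <- vbasis (@fullv k V)] => x; rewrite -[x]lquot_reprK.
rewrite (coord_vbasis (memvf (lquot_repr x))) linear_sum.
elim/big_rec: _ => [|i y _ ys]; first exact: lspan0.
rewrite linearZ; apply: lspanD => //; apply: lspanZ; apply: lspan_mem.
by apply: map_f; rewrite mem_nth ?size_tuple.
Qed.

HB.instance Definition _ :=
  Lmodule_hasFinDim.Build k (lquot I) (projT2 (findim_axiom lquot_findim)).

End VectorQuotient.

Section LieQuotient.
Variables (k : fieldType) (L : lieType k) (I : lieIdeal L).

Definition liequot := lquot I.
HB.instance Definition _ := GRing.Lmodule.on liequot.

Definition liequot_lie (x y : liequot) : liequot :=
  lquot_proj I (lie (lquot_repr x) (lquot_repr y)).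

Lemma liequot_projM x y :
  lquot_proj I (lie x y) = liequot_lie (lquot_proj I x) (lquot_proj I y).
Proof.
apply/lquot_eq; set x' := lquot_repr _; set y' := lquot_repr _.
have Ix : x - x' \in I by apply/lquot_eq; rewrite lquot_reprK.
have Iy : y - y' \in I by apply/lquot_eq; rewrite lquot_reprK.
have -> : lie x y - lie x' y' = lie x (y - y') - lie y' (x - x').
  by rewrite -(lieC (x - x')) lieBl lieBr addrA addrNK.
by rewrite -[- lie _ _]scaleN1r; apply: rpredD; [|apply: rpredZ]; exact: lie_idealP.
Qed.

Lemma liequot_ind (P : liequot -> Prop) :
  (forall x, P (lquot_proj I x)) -> forall x, P x.
Proof. by move=> PI x; rewrite -[x]lquot_reprK. Qed.

Fact liequot_lieDl x y z : liequot_lie (x + y) z = liequot_lie x z + liequot_lie y z.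
Proof.
by elim/liequot_ind: x => x; elim/liequot_ind: y => y; elim/liequot_ind: z => z; rewrite -[X in liequot_lie X _]linearD -!liequot_projM lieDl linearD.
Qed.
Fact liequot_lieDr x y z : liequot_lie x (y + z) = liequot_lie x y + liequot_lie x z.
Proof.
by elim/liequot_ind: x => x; elim/liequot_ind: y => y; elim/liequot_ind: z => z; rewrite -[X in liequot_lie _ X]linearD -!liequot_projM lieDr linearD.
Qed.
Fact liequot_lieZl a x y : liequot_lie (a *: x) y = a *: liequot_lie x y.
Proof.
by elim/liequot_ind: x => x; elim/liequot_ind: y => y; rewrite -[X in liequot_lie X _]linearZ -!liequot_projM lieZl linearZ.
Qed.
Fact liequot_lieZr a x y : liequot_lie x (a *: y) = a *: liequot_lie x y.
Proof.
by elim/liequot_ind: x => x; elim/liequot_ind: y => y; rewrite -[X in liequot_lie _ X]linearZ -!liequot_projM lieZr linearZ.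
Qed.
Fact liequot_liexx x : liequot_lie x x = 0.
Proof. by elim/liequot_ind: x => x; rewrite -!liequot_projM liexx linear0. Qed.
Fact liequot_jacobi x y z :
  liequot_lie x (liequot_lie y z) + liequot_lie y (liequot_lie z x)
    + liequot_lie z (liequot_lie x y) = 0.
Proof.
by elim/liequot_ind: x => x; elim/liequot_ind: y => y; elim/liequot_ind: z => z; rewrite -!liequot_projM -!linearD lie_jacobi linear0.
Qed.

HB.instance Definition _ := Lmodule_isLie.Build k liequot
  liequot_lieDl liequot_lieDr liequot_lieZl liequot_lieZr liequot_liexx liequot_jacobi.

Definition liequot_proj : L -> liequot := lquot_proj I.
Definition liequot_repr : liequot -> L := @lquot_repr k L I.

HB.instance Definition _ := GRing.Linear.on liequot_proj.

Lemma liequot_reprK : cancel liequot_repr liequot_proj.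
Proof. exact: lquot_reprK. Qed.

Lemma liequot_eq0 x : liequot_proj x = 0 <-> x \in I.
Proof. exact: lquot_eq0. Qed.

Lemma liequot_proj_lie x y : liequot_proj (lie x y) = lie (liequot_proj x) (liequot_proj y).
Proof. exact: liequot_projM. Qed.

End LieQuotient.

HB.instance Definition _ (k : fieldType) (L : vectLieType k) (I : lieIdeal L) :=
  Vector.copy (liequot I) (lquot I).

Section FreeLie.
Variables (k : fieldType) (d : nat).

Inductive lterm :=
| LGen of 'I_d
| LZero
| LAdd of lterm & lterm
| LScale of k & lterm
| LLie of lterm & lterm.

(* The least congruence making the quotient of lterm a Lie algebra. *)
Inductive lcong : lterm -> lterm -> Prop :=
| lcong_refl x : lcong x x
| lcong_sym x y : lcong x y -> lcong y x
| lcong_trans x y z : lcong x y -> lcong y z -> lcong x z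
| lcong_add x x' y y' : lcong x x' -> lcong y y' -> lcong (LAdd x y) (LAdd x' y')
| lcong_scale a x x' : lcong x x' -> lcong (LScale a x) (LScale a x')
| lcong_lie x x' y y' : lcong x x' -> lcong y y' -> lcong (LLie x y) (LLie x' y')
| lcong_addA x y z : lcong (LAdd x (LAdd y z)) (LAdd (LAdd x y) z)
| lcong_addC x y : lcong (LAdd x y) (LAdd y x)
| lcong_add0 x : lcong (LAdd LZero x) x
| lcong_addN x : lcong (LAdd (LScale (-1) x) x) LZero
| lcong_scaleA a b x : lcong (LScale a (LScale b x)) (LScale (a * b) x)
| lcong_scale1 x : lcong (LScale 1 x) x
| lcong_scaleDr a x y : lcong (LScale a (LAdd x y)) (LAdd (LScale a x) (LScale a y))
| lcong_scaleDl a b x : lcong (LScale (a + b) x) (LAdd (LScale a x) (LScale b x))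
| lcong_lieDl x y z : lcong (LLie (LAdd x y) z) (LAdd (LLie x z) (LLie y z))
| lcong_lieDr x y z : lcong (LLie x (LAdd y z)) (LAdd (LLie x y) (LLie x z))
| lcong_lieZl a x y : lcong (LLie (LScale a x) y) (LScale a (LLie x y))
| lcong_lieZr a x y : lcong (LLie x (LScale a y)) (LScale a (LLie x y))
| lcong_liexx x : lcong (LLie x x) LZero
| lcong_jacobi x y z :
    lcong (LAdd (LAdd (LLie x (LLie y z)) (LLie y (LLie z x))) (LLie z (LLie x y)))
          LZero.

HB.instance Definition _ := gen_eqMixin lterm.
HB.instance Definition _ := gen_choiceMixin lterm.

Definition lcongb : rel lterm := fun x y => `[< lcong x y >].

Fact lcongb_equiv : equiv_class_of lcongb.
Proof.
split=> [x|x y|y x z]; first by apply/asboolP; exact: lcong_refl.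
  by apply/asboolP/asboolP; exact: lcong_sym.
by move=> /asboolP xy /asboolP yz; apply/asboolP; exact: lcong_trans xy yz.
Qed.

Canonical lcongb_equivRel := EquivRelPack lcongb_equiv.
Canonical lcongb_encModRel := defaultEncModRel lcongb.

Definition freelie := {eq_quot lcongb}.
HB.instance Definition _ := EqQuotient.on freelie.
HB.instance Definition _ := Choice.on freelie.

Definition fl_proj : lterm -> freelie := fun x => \pi_freelie x.
Definition fl_repr : freelie -> lterm := fun x => repr x.

Lemma fl_reprK : cancel fl_repr fl_proj.
Proof. exact: reprK. Qed.

Lemma fl_ind (P : freelie -> Prop) : (forall x, P (fl_proj x)) -> forall x, P x.
Proof. by move=> PI x; rewrite -[x]fl_reprK. Qed.

Lemma fl_eq x y : fl_proj x = fl_proj y <-> lcong x y.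
Proof.
split=> [/eqP|xy]; first by rewrite (eqmodE lcongb_equivRel) => /asboolP.
by apply/eqP; rewrite (eqmodE lcongb_equivRel); apply/asboolP.
Qed.

Lemma fl_reprP x : lcong (fl_repr (fl_proj x)) x.
Proof. by apply/fl_eq; rewrite fl_reprK. Qed.

Definition fl_gen i : freelie := fl_proj (LGen i).
Definition fl_zero : freelie := fl_proj LZero.
Definition fl_add (x y : freelie) : freelie := fl_proj (LAdd (fl_repr x) (fl_repr y)).
Definition fl_opp (x : freelie) : freelie := fl_proj (LScale (-1) (fl_repr x)).
Definition fl_scale a (x : freelie) : freelie := fl_proj (LScale a (fl_repr x)).
Definition fl_lie (x y : freelie) : freelie := fl_proj (LLie (fl_repr x) (fl_repr y)).

Lemma fl_addE x y : fl_add (fl_proj x) (fl_proj y) = fl_proj (LAdd x y).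
Proof. by apply/fl_eq; apply: lcong_add; exact: fl_reprP. Qed.
Lemma fl_oppE x : fl_opp (fl_proj x) = fl_proj (LScale (-1) x).
Proof. by apply/fl_eq; apply: lcong_scale; exact: fl_reprP. Qed.
Lemma fl_scaleE a x : fl_scale a (fl_proj x) = fl_proj (LScale a x).
Proof. by apply/fl_eq; apply: lcong_scale; exact: fl_reprP. Qed.
Lemma fl_lieE x y : fl_lie (fl_proj x) (fl_proj y) = fl_proj (LLie x y).
Proof. by apply/fl_eq; apply: lcong_lie; exact: fl_reprP. Qed.

Let flE := (fl_addE, fl_oppE, fl_scaleE, fl_lieE).

Fact fl_addA : associative fl_add.
Proof.
elim/fl_ind=> x; elim/fl_ind=> y; elim/fl_ind=> z; rewrite !flE.
by apply/fl_eq; constructor.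
Qed.
Fact fl_addC : commutative fl_add.
Proof.
elim/fl_ind=> x; elim/fl_ind=> y; rewrite !flE; apply/fl_eq; exact: lcong_addC.
Qed.
Fact fl_add0 : left_id fl_zero fl_add.
Proof. elim/fl_ind=> x; rewrite !flE; apply/fl_eq; exact: lcong_add0. Qed.
Fact fl_addN : left_inverse fl_zero fl_opp fl_add.
Proof. elim/fl_ind=> x; rewrite !flE; apply/fl_eq; exact: lcong_addN. Qed.

HB.instance Definition _ :=
  GRing.isZmodule.Build freelie fl_addA fl_addC fl_add0 fl_addN.

Fact fl_scaleA a b x : fl_scale a (fl_scale b x) = fl_scale (a * b) x.
Proof. elim/fl_ind: x => x; rewrite !flE; apply/fl_eq; exact: lcong_scaleA. Qed.
Fact fl_scale1 : left_id 1 fl_scale.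
Proof. elim/fl_ind=> x; rewrite !flE; apply/fl_eq; exact: lcong_scale1. Qed.
Fact fl_scaleDr : right_distributive fl_scale +%R.
Proof.
move=> a; elim/fl_ind=> x; elim/fl_ind=> y; rewrite /GRing.add /= !flE.
by apply/fl_eq; exact: lcong_scaleDr.
Qed.
Fact fl_scaleDl x : {morph fl_scale^~ x : a b / a + b}.
Proof.
move=> a b; elim/fl_ind: x => x; rewrite [RHS]/GRing.add /= !flE.
by apply/fl_eq; exact: lcong_scaleDl.
Qed.

HB.instance Definition _ := GRing.Zmodule_isLmodule.Build k freelie
  fl_scaleA fl_scale1 fl_scaleDr fl_scaleDl.

Fact fl_lieDl x y z : fl_lie (x + y) z = fl_lie x z + fl_lie y z.
Proof.
elim/fl_ind: x => x; elim/fl_ind: y => y; elim/fl_ind: z => z.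
by rewrite /GRing.add /= !flE; apply/fl_eq; exact: lcong_lieDl.
Qed.
Fact fl_lieDr x y z : fl_lie x (y + z) = fl_lie x y + fl_lie x z.
Proof.
elim/fl_ind: x => x; elim/fl_ind: y => y; elim/fl_ind: z => z.
by rewrite /GRing.add /= !flE; apply/fl_eq; exact: lcong_lieDr.
Qed.
Fact fl_lieZl a x y : fl_lie (a *: x) y = a *: fl_lie x y.
Proof.
elim/fl_ind: x => x; elim/fl_ind: y => y.
by rewrite /GRing.scale /= !flE; apply/fl_eq; exact: lcong_lieZl.
Qed.
Fact fl_lieZr a x y : fl_lie x (a *: y) = a *: fl_lie x y.
Proof.
elim/fl_ind: x => x; elim/fl_ind: y => y.
by rewrite /GRing.scale /= !flE; apply/fl_eq; exact: lcong_lieZr.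
Qed.
Fact fl_liexx x : fl_lie x x = 0.
Proof. by elim/fl_ind: x => x; rewrite !flE; apply/fl_eq; exact: lcong_liexx. Qed.
Fact fl_jacobi x y z :
  fl_lie x (fl_lie y z) + fl_lie y (fl_lie z x) + fl_lie z (fl_lie x y) = 0.
Proof.
elim/fl_ind: x => x; elim/fl_ind: y => y; elim/fl_ind: z => z.
by rewrite /GRing.add /= !flE; apply/fl_eq; exact: lcong_jacobi.
Qed.

HB.instance Definition _ := Lmodule_isLie.Build k freelie
  fl_lieDl fl_lieDr fl_lieZl fl_lieZr fl_liexx fl_jacobi.

Lemma freelie_ind (P : freelie -> Prop) :
  (forall i, P (fl_gen i)) -> P 0 -> (forall x y, P x -> P y -> P (x + y)) ->
  (forall a x, P x -> P (a *: x)) -> (forall x y, P x -> P y -> P (lie x y)) ->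
  forall x, P x.
Proof.
move=> Pg P0 PD PZ PL; elim/fl_ind; elim=> //= [x Px y Py|a x Px|x Px y Py].
- by rewrite -fl_addE; exact: PD.
- by rewrite -fl_scaleE; exact: PZ.
- by rewrite -fl_lieE; exact: PL.
Qed.

(* homog n x : x is homogeneous of degree n, with 0 homogeneous of every degree *)
Inductive homog : nat -> freelie -> Prop :=
| homog_gen i : homog 1 (fl_gen i)
| homog0 n : homog n 0
| homogD n x y : homog n x -> homog n y -> homog n (x + y)
| homogZ n a x : homog n x -> homog n (a *: x)
| homog_lie m n x y : homog m x -> homog n y -> homog (m + n) (lie x y).

(* The linear span of the homogeneous elements of degree at least n *)
Inductive fl_deg_ge (n : nat) : freelie -> Prop :=
| fl_deg_ge_homog m x : (n <= m)%N -> homog m x -> fl_deg_ge n x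
| fl_deg_geD x y : fl_deg_ge n x -> fl_deg_ge n y -> fl_deg_ge n (x + y)
| fl_deg_geZ a x : fl_deg_ge n x -> fl_deg_ge n (a *: x).

Lemma fl_deg_ge0 n : fl_deg_ge n 0.
Proof. exact: fl_deg_ge_homog (leqnn n) (homog0 n). Qed.

Lemma fl_deg_ge_leq m n x : (m <= n)%N -> fl_deg_ge n x -> fl_deg_ge m x.
Proof.
move=> mn; elim=> {x} [p x np|x y _ + _|a x _].
- exact: fl_deg_ge_homog (leq_trans mn np).
- exact: fl_deg_geD.
- exact: fl_deg_geZ.
Qed.

Lemma fl_deg_ge_lie m n x y :
  fl_deg_ge m x -> fl_deg_ge n y -> fl_deg_ge (m + n) (lie x y).
Proof.
move=> mx; elim=> {y} [q y nq hy|y z _ IHy _ IHz|a y _ IHy]; last 2 first.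
- by rewrite lieDr; exact: fl_deg_geD.
- by rewrite lieZr; exact: fl_deg_geZ.
elim: mx => {x} [p x mp hx|x z _ IHx _ IHz|a x _ IHx].
- exact: fl_deg_ge_homog (leq_add mp nq) (homog_lie hx hy).
- by rewrite lieDl; exact: fl_deg_geD.
- by rewrite lieZl; exact: fl_deg_geZ.
Qed.

Lemma fl_deg_ge1 x : fl_deg_ge 1 x.
Proof.
elim/freelie_ind: x => [i||x y|a x|x y hx hy].
- exact: fl_deg_ge_homog (leqnn 1) (homog_gen i).
- exact: fl_deg_ge0.
- exact: fl_deg_geD.
- exact: fl_deg_geZ.
- exact: fl_deg_ge_leq (fl_deg_ge_lie hx hy).
Qed.


Definition fl_pow (n : nat) : pred freelie := fun x => `[< fl_deg_ge n x >].

Fact fl_pow_submod n : submod_closed (fl_pow n).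
Proof.
split=> [|a x y /asboolP nx /asboolP ny]; apply/asboolP; first exact: fl_deg_ge0.
by apply: fl_deg_geD ny; exact: fl_deg_geZ.
Qed.

Fact fl_pow_ideal n : lie_ideal_closed (fl_pow n).
Proof.
move=> x y /asboolP ny; apply/asboolP.
exact: fl_deg_ge_leq (fl_deg_ge_lie (fl_deg_ge1 x) ny).
Qed.

HB.instance Definition _ n :=
  GRing.isSubmodClosed.Build k freelie (fl_pow n) (fl_pow_submod n).
HB.instance Definition _ n := isLieIdeal.Build k freelie (fl_pow n) (@fl_pow_ideal n).

Definition fl_ideal n : lieIdeal freelie := LieIdeal.clone _ _ (fl_pow n) _.

Lemma homog_gt0 n x : homog n x -> x = 0 \/ (0 < n)%N.
Proof.
elim=> {n x} [i|n|n x y _ IHx _ IHy|n a x _ IHx|m n x y _ IHx _ IHy]; try by right.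
- by left.
- by case: IHx IHy => [->|]; [case=> [->|]; [left; rewrite addr0|right]|right].
- by case: IHx => [->|]; [left; rewrite scaler0|right].
- case: IHx => [->|m0]; first by left; rewrite lie0l.
  by right; rewrite addn_gt0 m0.
Qed.

Lemma lspan_lie (s : seq freelie) x y : lspan s x -> lspan s y ->
  lspan [seq lie u v | u <- s, v <- s] (lie x y).
Proof.
move=> sx; elim=> {y} [v sv||y z _ IHy _ IHz|a y _ IHy]; last 3 first.
- by rewrite lie0r; exact: lspan0.
- by rewrite lieDr; exact: lspanD.
- by rewrite lieZr; exact: lspanZ.
elim: sx => {x} [u su||x z _ IHx _ IHz|a x _ IHx]; last 3 first.
- by rewrite lie0l; exact: lspan0.
- by rewrite lieDl; exact: lspanD.
- by rewrite lieZl; exact: lspanZ.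
by apply: lspan_mem; apply/allpairsP; exists (u, v).
Qed.

Lemma lspan_sub (V : lmodType k) (s s' : seq V) x :
  {subset s <= s'} -> lspan s x -> lspan s' x.
Proof.
move=> ss'; elim=> {x} [x /ss'||x y _ + _|a x _].
- exact: lspan_mem.
- exact: lspan0.
- exact: lspanD.
- exact: lspanZ.
Qed.

Lemma homog_findim n : exists s : seq freelie,
  forall m x, (m <= n)%N -> homog m x -> lspan s x.
Proof.
elim: n => [|n [s sP]].
  exists [::] => m x; rewrite leqn0 => /eqP-> /homog_gt0[->|//]; exact: lspan0.
exists (codom fl_gen ++ [seq lie u v | u <- s, v <- s]) => m x mn hx.
elim: hx mn => {m x} [i|m|m x y _ IHx _ IHy|m a x _ IHx|m p x y hx _ hy _] mn.
- by apply: lspan_mem; rewrite mem_cat codom_f.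
- exact: lspan0.
- by apply: lspanD; [exact: IHx|exact: IHy].
- by apply: lspanZ; exact: IHx.
case: (homog_gt0 hx) => [->|m0]; first by rewrite lie0l; exact: lspan0.
case: (homog_gt0 hy) => [->|p0]; first by rewrite lie0r; exact: lspan0.
apply: (@lspan_sub _ [seq lie u v | u <- s, v <- s]).
  by move=> z sz; rewrite mem_cat sz orbT.
apply: lspan_lie; [apply: sP hx|apply: sP hy]; rewrite -ltnS.
  by apply: leq_trans mn; rewrite -[X in (X < _)%N]addn0 ltn_add2l.
by apply: leq_trans mn; rewrite -[X in (X < _)%N]add0n ltn_add2r.
Qed.

End FreeLie.

Section FreeNilpotent.
Variables (k : fieldType) (d t : nat).

Definition freenil := liequot (fl_ideal k d t.+1).
HB.instance Definition _ := Lie.on freenil.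

Definition fn_proj : freelie k d -> freenil := @liequot_proj k _ (fl_ideal k d t.+1).

Definition fn_gen (i : 'I_d) : freenil := fn_proj (fl_gen k i).

Lemma freenil_findim : exists s : seq freenil, forall x, lspan s x.
Proof.
have [s sP] := @homog_findim k d t; exists (map fn_proj s) => x.
rewrite -[x]liequot_reprK; elim: (fl_deg_ge1 (liequot_repr x)) => {x}.
- move=> m x _ hx; have [mt|tm] := leqP m t; last first.
    suff -> : liequot_proj (fl_ideal k d t.+1) x = 0 by exact: lspan0.
    by apply/liequot_eq0/asboolP; exact: fl_deg_ge_homog tm hx.
  elim: (sP m x mt hx) => {x hx} [x sx||x y _ hx _ hy|a x _ hx].
  + by apply: lspan_mem; exact: map_f.
  + by rewrite linear0; exact: lspan0.
  + by rewrite linearD; exact: lspanD.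
  + by rewrite linearZ; exact: lspanZ.
- by move=> x y _ hx _ hy; rewrite linearD; exact: lspanD.
- by move=> a x _ hx; rewrite linearZ; exact: lspanZ.
Qed.

HB.instance Definition _ :=
  Lmodule_hasFinDim.Build k freenil (projT2 (findim_axiom freenil_findim)).

End FreeNilpotent.

Section LieNotions.
Variable k : fieldType.
Implicit Types L N R S : vectLieType k.

(* [U, V] is the span of all brackets; by bilinearity bases of U and V suffice. *)
Definition liev L (U V : {vspace L}) : {vspace L} :=
  <<[seq lie u v | u <- vbasis U, v <- vbasis V]>>%VS.

(* N ^ j, for j >= 1: N ^ 1 = N and N ^ j.+1 = [N, N ^ j] *)
Definition lcs N (j : nat) : {vspace N} := iter j.-1 (liev fullv) fullv.

Definition nilpotent_class (t : nat) N := lcs N t != 0%VS /\ lcs N t.+1 = 0%VS.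

Definition vquot (V : vectType k) (U : {vspace V}) : vectType k :=
  lquot (GRing.SubmodClosed.clone k V (pred_of_vspace U) _).

Definition lie_type N : nat := \dim (@fullv k (vquot (lcs N 2))).

Definition derived_series L (U : {vspace L}) (j : nat) : {vspace L} :=
  iter j (fun W => liev W W) U.

Definition solvable_vs L (U : {vspace L}) := exists j, derived_series U j = 0%VS.

Definition solvable L := solvable_vs (@fullv k L).

Definition semisimple S :=
  forall I : {vspace S}, lie_ideal_closed I -> solvable_vs I -> I = 0%VS.

Definition derivation L (D : 'End(L)) :=
  forall x y, D (lie x y) = lie (D x) y + lie x (D y).

Definition representation S (V : vectType k) (rho : S -> 'End(V)) :=
  linear rho /\
  forall x y, rho (lie x y) = (rho x \o rho y)%VF - (rho y \o rho x)%VF.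

Definition Levi_extension S R (sigma : S -> 'End(R)) :=
  [/\ semisimple S, solvable R, representation sigma & forall s, derivation (sigma s)].

Definition faithful S (V : vectType k) (rho : S -> 'End(V)) := injective rho.

Definition stable S (V : vectType k) (rho : S -> 'End(V)) (W : {pred V}) :=
  forall s x, x \in W -> rho s x \in W.

(* The endomorphism x + I |-> f x + I; meaningful when f maps I into itself. *)
Definition quot_end L (I : lieIdeal L) (f : 'End(L)) : 'End(liequot I) :=
  linfun (fun x : liequot I => liequot_proj I (f (liequot_repr x))).

Lemma quot_endE L (I : lieIdeal L) (f : 'End(L)) :
  (forall x, x \in I -> f x \in I) ->
  forall x, quot_end I f (liequot_proj I x) = liequot_proj I (f x).
Proof.
move=> fI.
have fE x : liequot_proj I (f (liequot_repr (liequot_proj I x))) = liequot_proj I (f x).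
  apply/lquot_eq; rewrite -linearB; apply: fI; apply/lquot_eq.
  exact: (lquot_reprK (liequot_proj I x)).
have flin : linear (fun x : liequot I => liequot_proj I (f (liequot_repr x))).
  move=> a x y; rewrite -{1}(liequot_reprK x) -{1}(liequot_reprK y).
  by rewrite -linearP fE !linearP.
pose g : {linear liequot I -> liequot I} :=
  HB.pack (fun x : liequot I => liequot_proj I (f (liequot_repr x)))
    (GRing.isLinear.Build k _ _ _ _ flin).
by move=> x; rewrite /quot_end -[LHS]/(linfun g _) lfunE /= fE.
Qed.

Definition quot_module S L (I : lieIdeal L) (tau : S -> 'End(L)) : S -> 'End(liequot I) :=
  fun s => quot_end I (tau s).

Definition lie_iso L N (f : L -> N) :=
  [/\ linear f, forall x y, f (lie x y) = lie (f x) (f y) & bijective f].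

End LieNotions.

Section Derivations.
Variables (k : fieldType) (d t : nat).
Local Notation FL := (freelie k d).
Local Notation N := (freenil k d t).
Local Notation pi := (@fn_proj k d t).

Section Extension.
Variable f : 'I_d -> N.

Fixpoint der_term (x : lterm k d) : N :=
  match x with
  | LGen i => f i
  | LZero => 0
  | LAdd x y => der_term x + der_term y
  | LScale a x => a *: der_term x
  | LLie x y => lie (der_term x) (pi (fl_proj y)) + lie (pi (fl_proj x)) (der_term y)
  end.

Let pL x y : pi (fl_proj (LLie x y)) = lie (pi (fl_proj x)) (pi (fl_proj y)).
Proof. by rewrite -fl_lieE; exact: liequot_proj_lie. Qed.
Let pD x y : pi (fl_proj (LAdd x y)) = pi (fl_proj x) + pi (fl_proj y).
Proof. by rewrite -fl_addE; exact: linearD. Qed.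
Let pZ a x : pi (fl_proj (LScale a x)) = a *: pi (fl_proj x).
Proof. by rewrite -fl_scaleE; exact: linearZ. Qed.

Lemma der_term_cong x y : lcong x y -> der_term x = der_term y.
Proof.
elim=> {x y} //=.
- by move=> x y z _ -> _ ->.
- by move=> x x' y y' _ -> _ ->.
- by move=> a x x' _ ->.
- by move=> x x' y y' /fl_eq-> -> /fl_eq-> ->.
- by move=> x y z; rewrite addrA.
- by move=> x y; rewrite addrC.
- by move=> x; rewrite add0r.
- by move=> x; rewrite scaleN1r addNr.
- by move=> a b x; rewrite scalerA.
- by move=> x; rewrite scale1r.
- by move=> a x y; rewrite scalerDr.
- by move=> a b x; rewrite scalerDl.
- by move=> x y z; rewrite pD !lieDl addrACA.
- by move=> x y z; rewrite pD !lieDr addrACA.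
- by move=> a x y; rewrite pZ !lieZl -scalerDr.
- by move=> a x y; rewrite pZ !lieZr -scalerDr.
- by move=> x; rewrite lieC addNr.
- move=> x y z; rewrite !pL !lieDr.
  move: (pi (fl_proj x)) (pi (fl_proj y)) (pi (fl_proj z)) => u v w.
  move: (der_term x) (der_term y) (der_term z) => x' y' z'.
  have J1 := lie_jacobi x' v w; have J2 := lie_jacobi u y' w; have J3 := lie_jacobi u v z'.
  rewrite !addrA (ACl ((1*6*8)*(2*4*9)*(3*5*7)))%AC /=.
  by rewrite J1 J2 J3 !addr0.
Qed.

Definition der_fl (x : FL) : N := der_term (fl_repr x).

Lemma der_flE x : der_fl (fl_proj x) = der_term x.
Proof. by apply: der_term_cong; exact: fl_reprP. Qed.

Lemma der_fl_linear : linear der_fl.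
Proof.
move=> a; elim/fl_ind=> x; elim/fl_ind=> y.
rewrite [a *: _]fl_scaleE [_ + fl_proj y]fl_addE.
by rewrite !der_flE.
Qed.

Lemma der_fl_lie x y : der_fl (lie x y) = lie (der_fl x) (pi y) + lie (pi x) (der_fl y).
Proof.
by elim/fl_ind: x => x; elim/fl_ind: y => y; rewrite [lie _ _ in LHS]fl_lieE !der_flE.
Qed.

Lemma der_fl_pow x : fl_deg_ge t.+1 x -> der_fl x = 0.
Proof.
pose F : {linear FL -> N} := HB.pack der_fl (GRing.isLinear.Build k _ _ _ _ der_fl_linear).
have D0 : der_fl 0 = 0 by exact: (linear0 F).
have DD u v : der_fl (u + v) = der_fl u + der_fl v by exact: (linearD F).
have DZ a u : der_fl (a *: u) = a *: der_fl u.
  by rewrite -[a *: u]addr0 der_fl_linear D0 addr0.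
have Dh m u : homog m u -> exists2 v, fl_deg_ge m v & der_fl u = pi v.
  elim=> {m u} [i|m|m u v _ [u' hu Du] _ [v' hv Dv]|m a u _ [u' hu Du]|].
  - by exists (liequot_repr (der_fl (fl_gen k i))); [exact: fl_deg_ge1|rewrite [RHS]liequot_reprK].
  - by exists 0; [exact: fl_deg_ge0|rewrite D0 [RHS]linear0].
  - by exists (u' + v'); [exact: fl_deg_geD|rewrite DD Du Dv [RHS]linearD].
  - by exists (a *: u'); [exact: fl_deg_geZ|rewrite DZ Du [RHS]linearZ].
  move=> m n u v hu [u' hu' Du] hv [v' hv' Dv].
  exists (lie u' v + lie u v').
    apply: fl_deg_geD; apply: fl_deg_ge_lie => //; first exact: fl_deg_ge_homog hv.
    exact: fl_deg_ge_homog hu.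
  rewrite der_fl_lie Du Dv [RHS]linearD.
  by congr (_ + _); symmetry; exact: liequot_proj_lie.
elim=> {x} [m x tm /Dh[v hv ->]|x y _ hx _ hy|a x _ hx].
- by apply/liequot_eq0/asboolP; exact: fl_deg_ge_leq hv.
- by rewrite DD hx hy addr0.
- by rewrite DZ hx scaler0.
Qed.

Lemma der_exists : exists D : 'End(N), derivation D /\ forall i, D (fn_gen k t i) = f i.
Proof.
pose F : {linear FL -> N} := HB.pack der_fl (GRing.isLinear.Build k _ _ _ _ der_fl_linear).
pose g x := der_fl (liequot_repr (x : N)).
have gE x : g (pi x) = der_fl x.
  apply/eqP; rewrite -subr_eq0; apply/eqP; rewrite -[LHS](linearB F).
  apply: der_fl_pow; apply/asboolP.
  by apply/(@lquot_eq k _ (fl_ideal k d t.+1)); exact: (lquot_reprK (pi x)).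
have glin : linear g.
  move=> a x y; rewrite -{1}(liequot_reprK x) -{1}(liequot_reprK y).
  by rewrite -[X in g X]linearP gE; exact: (linearP F).
pose G : {linear N -> N} := HB.pack g (GRing.isLinear.Build k _ _ _ _ glin).
exists (linfun G); split=> [x y|i]; rewrite !lfunE /=; last first.
  by rewrite /fn_gen gE /fl_gen der_flE.
rewrite -{1}(liequot_reprK x) -{1}(liequot_reprK y) -[X in g X]liequot_proj_lie gE.
by rewrite der_fl_lie /fn_proj !liequot_reprK.
Qed.

End Extension.

Lemma der_unique (D D' : 'End(N)) : derivation D -> derivation D' ->
  (forall i, D (fn_gen k t i) = D' (fn_gen k t i)) -> D = D'.
Proof.
move=> dD dD' DD'; apply/lfunP => x; rewrite -(liequot_reprK x).
elim/freelie_ind: (liequot_repr x) => {x} [||x y hx hy|a x hx|x y hx hy].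
- exact: DD'.
- by rewrite !linear0.
- by rewrite linearD [LHS]linearD [RHS]linearD; congr (_ + _).
- by rewrite linearZ [LHS]linearZ [RHS]linearZ; congr (_ *: _).
- by rewrite liequot_proj_lie dD dD' -[D (_ _)]/(D _) hx hy.
Qed.

Section Delta.
Variables (m : vectType k) (X : d.-tuple m).

(* Here X is meant to be a basis of m; m embeds into N_{d,t} by X_i |-> i-th generator. *)
Definition fn_inj : 'Hom(m, N) := linfun (fun v => \sum_i coord X i v *: fn_gen k t i).

Definition der_ext (delta : 'Hom(m, N)) : 'End(N) :=
  projT1 (cid (der_exists (fun i => delta X`_i))).

Definition Delta (delta : 'End(m)) : 'End(N) := der_ext (fn_inj \o delta)%VF.

Lemma fn_injE (i : 'I_d) : basis_of fullv X -> fn_inj X`_i = fn_gen k t i.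
Proof.
move=> /basis_free freeX.
pose F (v : m) : N := \sum_i coord X i v *: fn_gen k t i.
have Flin : linear F.
  move=> a u v; rewrite /F scaler_sumr -big_split /=; apply: eq_bigr => j _.
  by rewrite linearP scalerDl scalerA.
pose G : {linear m -> N} := HB.pack F (GRing.isLinear.Build k _ _ _ _ Flin).
rewrite -[LHS]/(linfun G _) lfunE /= /F (bigD1 i) //= coord_free // eqxx scale1r.
by rewrite big1 ?addr0 // => j ji; rewrite coord_free // eq_sym (negPf ji) scale0r.
Qed.

Lemma der_extP (delta : 'Hom(m, N)) : basis_of fullv X ->
  derivation (der_ext delta) /\ forall v, der_ext delta (fn_inj v) = delta v.
Proof.
move=> basX; rewrite /der_ext; case: cid => D [dD DX]; split=> //= v.
rewrite (coord_basis basX (memvf v)) !linear_sum; apply: eq_bigr => i _.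
rewrite !linearZ; congr (_ *: _); rewrite -[RHS](DX i); congr (D _); exact: fn_injE.
Qed.

End Delta.

End Derivations.

(* Main.v *)
Require Import Defs.
From HB Require Import structures.
From mathcomp Require Import all_boot all_order all_algebra.
From mathcomp Require Import falgebra fieldext boolp ring.

Set Implicit Arguments.
Unset Strict Implicit.
Unset Printing Implicit Defensive.

Import Order.TTheory GRing.Theory Num.Theory VectorInternalTheory.

Local Open Scope ring_scope.

(* The substance is that N^2 has an S-stable complement m in N (Weyl's theorem):
   m generates the nilpotent Lie algebra N, so the map from the free nilpotent
   Lie algebra on m onto N that extends the inclusion is S-equivariant, and N is
   its quotient by the kernel.

   Weyl's theorem is derived from Cartan's criterion.  If tr(xy) = 0 on an ideal
   of operators, every x in its derived algebra is nilpotent: for a Q-linear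
   function f on the span of the eigenvalues a of x, the polynomial q(x) acting
   as f(a) on each generalized eigenspace has ad q(x) = p(ad x) for some p, hence
   is orthogonal to x, and sum f(a)^2 = 0 follows.  Engel's theorem concludes.
   So S is the sum of the kernel of any representation and its Killing
   complement T, and the trace form is nondegenerate on T.  If b_i, c_i are dual
   bases of T and delta is a 1-cocycle, then m0 = sum b_i delta(c_i) satisfies
   x m0 = Gamma delta(x) with Gamma = sum b_i c_i the Casimir element, which is
   not nilpotent since its trace is dim T; the Fitting decomposition of Gamma and
   induction on the dimension make delta a coboundary. *)

(** * Traces, interpolation and splitting extensions *)

Section MatrixTrace.
Variable F : fieldType.

Lemma mulmx_base_inj n r (C : 'M[F]_(n, r)) (R : 'M[F]_(r, n)) (A B : 'M[F]_r) :
  row_full C -> row_free R -> C *m A *m R = C *m B *m R -> A = B.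
Proof.
by move=> Cf Rf /(row_free_inj Rf) /(row_full_inj Cf).
Qed.

Lemma rank_factorization n (A : 'M[F]_n) :
  exists r (C : 'M[F]_(n, r)) (R : 'M[F]_(r, n)),
    [/\ A = C *m R, row_full C, row_free R & r = \rank A].
Proof.
exists (\rank A), (col_base A), (row_base A).
by split=> //; [rewrite mulmx_base|exact: col_base_full|exact: row_base_free].
Qed.

(** For a rank factorization [A = C *m R] the trace equals that of [R *m C], whose nilpotency
    exponent is one less, since [A ^+ m.+1 = C *m (R *m C) ^+ m *m R]. *)
Lemma mxtrace_nilp N n (A : 'M[F]_n) : A ^+ N = 0 -> \tr A = 0.
Proof.
elim: N n A => [|N IH] n A AN.
  by rewrite -[A]mulr1 -(expr0 A) AN mulr0 linear0.
have [r [C [R [AE Cf Rf _]]]] := rank_factorization A.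
rewrite AE mxtrace_mulC; apply: IH.
have EX m : A ^+ m.+1 = C *m (R *m C) ^+ m *m R.
  elim: m => [|m IHm]; first by rewrite expr0 mulmx1 AE expr1.
  by rewrite exprS IHm {1}AE exprS -!mulmxE !mulmxA.
by apply: (mulmx_base_inj Cf Rf); rewrite -EX AN mulmx0 mul0mx.
Qed.

(** Cancelling [C] and [R] in [C *m R *m C *m R = C *m R] leaves [R *m C = 1], an identity matrix of
    size [\rank A]. *)
Lemma mxtrace_idem n (A : 'M[F]_n) : A *m A = A -> \tr A = (\rank A)%:R.
Proof.
move=> AA; have [r [C [R [AE Cf Rf <-]]]] := rank_factorization A.
rewrite {1}AE mxtrace_mulC -[RHS]mxtrace1; congr (\tr _).
by apply: (mulmx_base_inj Cf Rf); rewrite mulmx1 -AE -[RHS]AA AE !mulmxA.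
Qed.

End MatrixTrace.

Lemma poly_interpolation (F : fieldType) (s : seq F) (g : F -> F) N :
  exists p : {poly F}, forall c, c \in s -> ('X - c%:P) ^+ N %| p - (g c)%:P.
Proof.
elim: s => [|a s [p Hp]]; first by exists 0.
have [as_|nas] := boolP (a \in s).
  by exists p => c; rewrite inE => /orP[/eqP->|]; exact: Hp.
pose P := \prod_(c <- s) ('X - c%:P) ^+ N.
have cop : coprimep (('X - a%:P) ^+ N) P.
  rewrite /P; elim: (s) nas => [|c r IHr]; first by rewrite big_nil coprimep1.
  rewrite inE negb_or big_cons => /andP[ac /IHr cr].
  rewrite coprimepMr cr andbT coprimep_expl // coprimep_expr //.
  by rewrite coprimep_XsubC root_XsubC eq_sym.
have [[u v] /= uv] := elimT (Bezout_eq1_coprimepP _ _) cop.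
(* [v * P] is 1 modulo [('X - a%:P) ^+ N] and 0 modulo the powers at the other nodes, so the
   correction changes only the value at [a]. *)
exists (p + v * P * ((g a)%:P - p)) => c; rewrite inE => /orP[/eqP->|cs].
  have -> : p + v * P * ((g a)%:P - p) - (g a)%:P = (1 - v * P) * (p - (g a)%:P).
    by ring.
  by rewrite -uv addrK -mulrA mulrCA dvdp_mulIl.
have -> : p + v * P * ((g a)%:P - p) - (g c)%:P
   = (p - (g c)%:P) + v * P * ((g a)%:P - p) by rewrite addrAC.
rewrite dvdp_add ?Hp // dvdp_mulr // dvdp_mull //.
by rewrite /P (big_rem c) //= dvdp_mulIl.
Qed.

Section PolynomialAction.
Variables (F : fieldType) (V : lmodType F).

(** The value of [p(T)] at [z]. Iterates, rather than a matrix of [T], let it be used directly for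
    [mx_ad x], an operator on matrices. *)
Definition pact (p : {poly F}) (T : V -> V) z := \sum_(j < size p) p`_j *: iter j T z.

Lemma pact_widen n (p : {poly F}) T z : (size p <= n)%N ->
  pact p T z = \sum_(j < n) p`_j *: iter j T z.
Proof.
move=> pn; rewrite /pact (big_ord_widen _ (fun j => p`_j *: iter j T z) pn).
rewrite [RHS](bigID (fun j : 'I_n => (j < size p)%N)) /= [X in _ + X]big1 ?addr0 //.
by move=> j; rewrite -leqNgt => /leq_sizeP->//; rewrite scale0r.
Qed.

Lemma pactD p q T z : pact (p + q) T z = pact p T z + pact q T z.
Proof.
pose n := maxn (size p) (size q).
rewrite (@pact_widen n p) ?leq_maxl // (@pact_widen n q) ?leq_maxr //.
rewrite (@pact_widen n) ?size_polyD // -big_split /=.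
by apply: eq_bigr => i _; rewrite coefD scalerDl.
Qed.

Lemma pactZ a p T z : pact (a *: p) T z = a *: pact p T z.
Proof.
rewrite (@pact_widen (size p)) ?size_scale_leq // scaler_sumr.
by apply: eq_bigr => i _; rewrite coefZ scalerA.
Qed.

Lemma pactMX p T z : pact (p * 'X) T z = pact p T (T z).
Proof.
rewrite (@pact_widen (size p).+1); last first.
  by have [->|p0] := eqVneq p 0; rewrite ?mul0r ?size_poly0 // size_mulX.
rewrite big_ord_recl coefMX scale0r add0r; apply: eq_bigr => i _.
by rewrite coefMX -iterSr.
Qed.

Lemma pactC c T z : pact c%:P T z = c *: z.
Proof.
by rewrite (@pact_widen 1) ?size_polyC_leq1 // big_ord1 coefC.
Qed.

Variable T : {linear V -> V}.

Lemma pact_linear p : linear (pact p T).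
Proof.
have iterP j a x y : iter j T (a *: x + y) = a *: iter j T x + iter j T y.
  by elim: j => //= j ->; rewrite linearP.
move=> a x y; rewrite /pact scaler_sumr -big_split; apply: eq_bigr => i _ /=.
by rewrite iterP scalerDr !scalerA mulrC.
Qed.

Lemma pactMXsubCX p c m z :
  pact (p * ('X - c%:P) ^+ m) T z = pact p T (iter m (fun v => T v - c *: v) z).
Proof.
elim: m z => [|m IH] z; first by rewrite expr0 mulr1.
rewrite exprSr mulrA mulrBr pactD pactMX [_ * c%:P]mulrC mul_polyC -scaleNr.
rewrite pactZ !IH scaleNr.
have lin_sum u v : pact p T u - c *: pact p T v = pact p T (u - c *: v).
  by rewrite -scaleNr addrC -pact_linear scaleNr addrC.
have comm : iter m (fun v => T v - c *: v) (T z) = T (iter m (fun v => T v - c *: v) z).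
  elim: m {IH} z => [//|m IH] z; rewrite !iterS IH.
  set B := iter m _ z; have := linearP T (- c) B (T B).
  by rewrite !scaleNr ![- _ + _]addrC => ->.
by rewrite lin_sum comm.
Qed.

(** Here [z] is a generalized eigenvector for [c], and [p] is the constant [a] modulo a power of
    ['X - c%:P] that kills [z]. *)
Lemma pact_eigen p a c m z : ('X - c%:P) ^+ m %| p - a%:P ->
  iter m (fun v => T v - c *: v) z = 0 -> pact p T z = a *: z.
Proof.
move=> /dvdpP[u pE] z0; rewrite -[p](subrK a%:P) pE pactD pactC pactMXsubCX z0.
by have := pact_linear u (-1) 0 0; rewrite scaler0 addr0 scaleN1r addNr => ->; rewrite add0r.
Qed.

End PolynomialAction.

(* Stands in for finiteness of the degree; unlike the latter, it passes to towers
   without any change of base field. *)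
Definition separated_extension (k K : fieldType) (iota : {rmorphism k -> K}) :=
  forall z : K, z != 0 -> exists phi : {additive K -> k},
    (forall a w, phi (iota a * w) = a * phi w) /\ phi z != 0.

Lemma irreducible_factor (F : fieldType) (p : {poly F}) : (1 < size p)%N ->
  exists2 q, irreducible_poly q & q %| p.
Proof.
move=> p1; pose P n := `[< exists q : {poly F}, [/\ (1 < size q)%N, q %| p & size q = n] >].
have exP : exists n, P n by exists (size p); apply/asboolP; exists p.
case: (ex_minnP exP) => n /asboolP[q [q1 qp qn]] min_n; exists q => //.
split=> // r r1 rq; rewrite -dvdp_size_eqp //.
have q0 : q != 0 by rewrite -size_poly_gt0 ltnW.
rewrite eqn_leq dvdp_leq //= qn; apply: min_n; apply/asboolP; exists r.
split=> //; last exact: dvdp_trans rq qp.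
have r0 : r != 0 by apply: dvdpN0 rq q0.
by move: r1 r0; rewrite -size_poly_gt0; case: (size r) => [|[]].
Qed.

(** Induction on the size of [p], for all base fields at once: adjoin a root of an irreducible
    factor, divide it out and split the quotient over the larger field. Separating functionals
    compose along the tower, the last one being a coordinate of the intermediate field over [k]. *)
Lemma splitting_extension (k : fieldType) (p : {poly k}) : p != 0 ->
  exists (K : fieldType) (iota : {rmorphism k -> K}), separated_extension iota /\
    exists rs : seq K, map_poly iota p %= \prod_(r <- rs) ('X - r%:P).
Proof.
move: {2}(size p) (leqnn (size p)) => n; elim: n k p => [|n IH] k p pn p0.
  by move: pn; rewrite leqn0 size_poly_eq0 (negPf p0).
have [p1|p1] := leqP (size p) 1.
  exists k, idfun; split=> [z z0|].
    by exists idfun.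
  exists [::]; rewrite big_nil map_poly_id // -size_poly_eq1 eqn_leq p1.
  by rewrite size_poly_gt0.
have [q irq qp] := irreducible_factor p1.
have [L _ [z rz _]] := irredp_FAdjoin irq.
have rp : root (map_poly (in_alg L) p) z.
  by rewrite -dvdp_XsubCl (@dvdp_trans _ (map_poly (in_alg L) q)) ?dvdp_XsubCl // dvdp_map.
have /factor_theorem[r pE] := rp.
have r0 : r != 0.
  by apply: contraNneq p0 => r0; rewrite -(map_poly_eq0 (in_alg L)) pE r0 mul0r.
have rn : (size r <= n)%N.
  by move: pn; rewrite -(size_map_poly (in_alg L)) pE size_Mmonic ?monicXsubC // size_XsubC addnC.
have [K [iota [iotaS [rs rE]]]] := IH L r rn r0.
exists K, (iota \o in_alg L); split; last first.
  exists (iota z :: rs); rewrite map_poly_comp pE rmorphM /= big_cons mulrC.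
  by rewrite map_polyXsubC eqp_mull.
move=> w w0; have [psi [psiZ psiw]] := iotaS w w0.
have /existsP[i ci] : [exists i, coord (vbasis {:L}) i (psi w) != 0].
  apply: contraR psiw; rewrite negb_exists => /forallP c0.
  rewrite (coord_vbasis (memvf (psi w))) big1 // => i _.
  by move: (c0 i); rewrite negbK => /eqP->; rewrite scale0r.
exists (coord (vbasis {:L}) i \o psi); split=> //= a v.
by rewrite psiZ mulr_algl linearZ.
Qed.

Lemma intr_eq0_pchar0 (K : fieldType) (m : int) : [pchar K] =i pred0 ->
  (m%:~R == 0 :> K) = (m == 0).
Proof.
move=> /pcharf0P K0; case: m => n /=; first by rewrite K0.
by rewrite NegzE mulrNz oppr_eq0 oppr_eq0 -pmulrn K0.
Qed.

(** [ratr] reads off the reduced fraction. Nonzero integers stay nonzero in [K], so every fraction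
    computes the same value, and the formulas for sums and products of fractions give a morphism. *)
Lemma rat_embedding (K : fieldType) : [pchar K] =i pred0 ->
  exists h : {rmorphism rat -> K}, True.
Proof.
move=> K0; have nz m : m != 0 -> m%:~R != 0 :> K by rewrite intr_eq0_pchar0.
have ratrE m n : n != 0 -> @ratr K (m%:~R / n%:~R) = m%:~R / n%:~R.
  move=> n0; set x := _ / _; rewrite /ratr.
  apply/eqP; rewrite eqr_div ?nz // -!intrM.
  have : (numq x)%:~R / (denq x)%:~R == m%:~R / n%:~R :> rat by rewrite divq_num_den.
  by rewrite eqr_div ?intr_eq0 ?denq_neq0 // -!intrM => /eqP/intr_inj->.
have dQ x : (denq x)%:~R != 0 :> rat by rewrite intr_eq0.
have dK x : (denq x)%:~R != 0 :> K by rewrite nz.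
have addm : zmod_morphism (@ratr K).
  move=> x y; rewrite -{1}[x]divq_num_den -{1}[y]divq_num_den.
  rewrite -mulNr addf_div // -mulrNz -!intrM -intrD ratrE ?mulf_neq0 //.
  by rewrite intrD !intrM mulrNz -addf_div // mulNr.
have mulm : monoid_morphism (@ratr K).
  split=> [|x y]; first by rewrite /ratr divr1.
  rewrite -{1}[x]divq_num_den -{1}[y]divq_num_den.
  by rewrite mulf_div -!intrM ratrE ?mulf_neq0 // !intrM -mulf_div.
by exists (HB.pack_for {rmorphism rat -> K} (@ratr K) (GRing.isZmodMorphism.Build _ _ _ addm)
             (GRing.isMonoidMorphism.Build _ _ _ mulm)).
Qed.

(** The rational relations among the [a i] form a rational subspace that misses the unit vector at
    [i0], because [a i0 != 0]. The [f i] are the coefficients of a linear form vanishing on that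
    subspace but not at this vector. *)
Lemma rational_functional (K : fieldType) (h : {rmorphism rat -> K}) r
    (a : 'I_r -> K) i0 : a i0 != 0 ->
  exists2 f : 'I_r -> rat, f i0 != 0 &
    forall c, \sum_i h (c i) * a i = 0 -> \sum_i c i * f i = 0.
Proof.
move=> a0; pose ev (u : 'rV[rat]_r) := \sum_i h (u 0 i) * a i.
have evP b u v : ev (b *: u + v) = h b * ev u + ev v.
  rewrite /ev mulr_sumr -big_split; apply: eq_bigr => i _ /=.
  by rewrite !mxE rmorphD rmorphM /= mulrDl mulrA.
pose P n := `[< exists M : 'M[rat]_r, (forall u, (u <= M)%MS -> ev u = 0) /\ \rank M = n >].
have exP : exists n, P n.
  exists 0%N; apply/asboolP; exists 0; split; last by rewrite mxrank0.
  by move=> u /submx0null->; rewrite /ev big1 // => i _; rewrite mxE rmorph0 mul0r.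
have bP n : P n -> (n <= r)%N by move=> /asboolP[M [_ <-]]; exact: rank_leq_col.
case: (ex_maxnP exP bP) => n /asboolP[M [Mev Mn]] max_n.
(* A space of relations of largest rank contains every relation, since otherwise adding one would
   enlarge it. *)
have Mmax u : ev u = 0 -> (u <= M)%MS.
  move=> u0; have : (\rank (M + u)%MS <= \rank M)%N.
    rewrite Mn; apply: max_n; apply/asboolP; exists (M + u)%MS; split=> //.
    move=> v /sub_addsmxP[[w1 w2] /= ->].
    have -> : w2 *m u = w2 0 0 *: u by rewrite {1}[w2]mx11_scalar mul_scalar_mx.
    by rewrite addrC evP u0 mulr0 add0r Mev // submxMl.
  rewrite (geq_leqif (mxrank_leqif_sup (addsmxSl M u))) addsmx_sub => /andP[_ //].
have ei : ~~ ((delta_mx 0 i0 : 'rV[rat]_r) <= M)%MS.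
  apply/negP => /Mev; move/eqP: a0 => a0; apply: contra_not a0.
  rewrite /ev (bigD1 i0) //= big1 ?addr0 => [|i ii0].
    by rewrite mxE !eqxx rmorph1 mul1r => ->.
  by rewrite mxE (negPf ii0) rmorph0 mul0r.
move: ei Mmax; rewrite submxE => ei Mmax.
have Mker u : ev u = 0 -> u *m cokermx M = 0 by move=> /Mmax; rewrite submxE => /eqP.
move: (cokermx M) ei Mker => C /rV0Pn[j]; rewrite -rowE mxE => Cj Mker.
exists (fun i => C i j) => // c c0.
have : (\row_i c i) *m C = 0.
  by apply: Mker; rewrite -[RHS]c0; apply: eq_bigr => i _; rewrite mxE.
move=> /rowP/(_ j); rewrite !mxE => cj0; apply: etrans cj0.
by apply: eq_bigr => i _; rewrite mxE.
Qed.

Section AdjointMatrix.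
Variables (F : fieldType) (n : nat).
Implicit Types x z A B : 'M[F]_n.+1.

Definition mx_ad x z := x * z - z * x.

Fact mx_ad_linear x : linear (mx_ad x).
Proof.
move=> a y z; rewrite /mx_ad mulrDl mulrDr -scalerAl -scalerAr scalerBr.
by rewrite opprD addrACA.
Qed.
HB.instance Definition _ x := GRing.isLinear.Build F _ _ _ (mx_ad x) (mx_ad_linear x).

(** Left multiplication by [A] and right multiplication by [B] commute, and every term
    [A ^+ i * z * B ^+ j] with [i + j = a + b] has [i >= a] or [j >= b]. Induction replaces the
    binomial expansion. *)
Lemma iter_ad_eq0 A B a b z : A ^+ a * z = 0 -> z * B ^+ b = 0 ->
  iter (a + b) (fun v => A * v - v * B) z = 0.
Proof.
have [m] := ubnP (a + b); elim: m => // m IH in a b z *.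
set T := fun v => _.
have T0 j : iter j T 0 = 0 by elim: j => //= j ->; rewrite /T mulr0 mul0r subr0.
have TB j u v : iter j T (u - v) = iter j T u - iter j T v.
  by elim: j => //= j ->; rewrite /T mulrBr mulrBl !opprD !opprK addrACA.
case: a => [|a] abm; first by rewrite expr0 mul1r => -> _; rewrite T0.
case: b => [|b] in abm *; first by rewrite expr0 mulr1 => _ ->; rewrite T0.
move=> Az zB; rewrite addSn iterSr [T z]/T TB.
have lt : (a.+1 + b < m)%N by rewrite addSnnS; move: abm; rewrite addSn ltnS.
rewrite (IH a b.+1) ?sub0r -?addSnnS //; first last.
- by rewrite -mulrA zB mulr0.
- by rewrite mulrA -exprSr.
rewrite (IH a.+1 b) ?oppr0 //; first by rewrite mulrA Az mul0r.
by rewrite -mulrA -exprS.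
Qed.

End AdjointMatrix.

(** * Nilpotency from trace orthogonality *)

Lemma prod_XsubCX_dvdp (F : fieldType) (s : seq F) N (p : {poly F}) : uniq s ->
  (forall a, a \in s -> ('X - a%:P) ^+ N %| p) -> \prod_(a <- s) ('X - a%:P) ^+ N %| p.
Proof.
elim: s => [|a s IH] /=; first by rewrite big_nil dvd1p.
move=> /andP[ns us] H; rewrite big_cons Gauss_dvdp.
  by rewrite H ?mem_head // IH // => b bs; rewrite H // inE bs orbT.
elim: s ns {IH us H} => [|c r IHr]; first by rewrite big_nil coprimep1.
rewrite inE negb_or big_cons => /andP[ac /IHr cr].
rewrite coprimepMr cr andbT coprimep_expl // coprimep_expr //.
by rewrite coprimep_XsubC root_XsubC eq_sym.
Qed.

(** Since bracketing with [q(x)] is a polynomial in bracketing with [x], it preserves every subspace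
    that the latter preserves, although [q(x)] itself may lie outside the Lie algebra at hand. *)
Definition ad_pair (F : fieldType) n (x : 'M[F]_n.+1) (q p : {poly F}) :=
  forall z, mx_ad (horner_mx x q) z = pact p (mx_ad x) z.

Section SplitNilpotent.
Variables (K : fieldType) (K0 : [pchar K] =i pred0) (n : nat) (x : 'M[K]_n.+1).
Variables (rs : seq K) (char_x : char_poly x %= \prod_(r <- rs) ('X - r%:P)).

Let us := undup rs.
(** Bounds the multiplicity of every root; the successor makes it positive, so that one factor can
    be split off in [tr_xE]. *)
Let N := (size rs).+1.
Let r := size us.
Let a (i : 'I_r) := us`_i.

Let a_inj : injective a.
Proof. by move=> i j /eqP; rewrite nth_uniq ?undup_uniq // => /eqP/val_inj. Qed.

(** Such a [p] is a multiple of the characteristic polynomial, so Cayley-Hamilton applies. *)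
Let horner_mx_eq0 p : (forall i, ('X - (a i)%:P) ^+ N %| p) -> horner_mx x p = 0.
Proof.
move=> H; have cp : char_poly x %| p.
  rewrite (eqp_dvdl _ char_x).
  apply: (@dvdp_trans _ (\prod_(c <- us) ('X - c%:P) ^+ N)); last first.
    apply: prod_XsubCX_dvdp; first exact: undup_uniq.
    by move=> c cs; have := H (Ordinal (etrans (index_mem c us) cs)); rewrite /a /= nth_index.
  rewrite -big_undup_iterop_count /=.
  apply: (big_ind2 (fun u v : {poly K} => u %| v)) => [|u1 u2 v1 v2|c _]; first exact: dvdpp.
    exact: dvdp_mul.
  by apply: dvdp_exp2l; rewrite ltnW // ltnS count_size.
have /dvdpP[u ->] := cp.
by rewrite rmorphM /= Cayley_Hamilton mulr0.
Qed.

Variables (e : 'I_r -> {poly K}).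
Hypothesis eP : forall i j, ('X - (a j)%:P) ^+ N %| e i - (j == i)%:R.

(** Congruent to 1 at [a i] and to 0 at the other eigenvalues, [e i] evaluates at [x] to the
    projector onto the generalized eigenspace of [a i]. *)
Let E i := horner_mx x (e i).

Let e_offdiag i j : j != i -> ('X - (a j)%:P) ^+ N %| e i.
Proof. by move=> ji; have := eP i j; rewrite (negPf ji) subr0. Qed.

Let E_mul_eq0 i p : ('X - (a i)%:P) ^+ N %| p -> horner_mx x p * E i = 0.
Proof.
move=> H; rewrite -rmorphM; apply: horner_mx_eq0 => j.
by have [->|ji] := eqVneq j i; [rewrite dvdp_mulr|rewrite dvdp_mull ?e_offdiag].
Qed.

Let E_sum : \sum_i E i = 1.
Proof.
apply/eqP; rewrite -subr_eq0 -(rmorph1 (horner_mx x)) -rmorph_sum -rmorphB.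
apply/eqP; apply: horner_mx_eq0 => j; rewrite (bigD1 j) //= addrAC dvdp_add //.
  by have := eP j j; rewrite eqxx.
apply: (big_ind (fun u => _ %| u)) => [|u v|i]; [exact: dvdp0|exact: dvdp_add|].
by rewrite eq_sym; exact: e_offdiag.
Qed.

Let E_idem i : E i * E i = E i.
Proof.
apply/eqP; rewrite -subr_eq0 -{3}[E i]mul1r -mulrBl -(rmorph1 (horner_mx x)) -rmorphB.
by rewrite E_mul_eq0 //; have := eP i i; rewrite eqxx.
Qed.

Let E_comm i p : E i * horner_mx x p = horner_mx x p * E i.
Proof. by rewrite -!rmorphM mulrC. Qed.

Let E_eigen i q c : ('X - (a i)%:P) ^+ N %| q - c%:P -> horner_mx x q * E i = c *: E i.
Proof.
move=> /E_mul_eq0 /eqP; rewrite rmorphB mulrBl subr_eq0 => /eqP->.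
by rewrite /= horner_mx_C -[c%:M]scalemx1 -scalerAl mul1r.
Qed.

Let hornerXsubC c : horner_mx x ('X - c%:P) = x - c%:M.
Proof. by rewrite rmorphB /= horner_mx_X horner_mx_C. Qed.

(** On its generalized eigenspace [x] is the scalar [a i] plus a nilpotent operator, and an
    idempotent has its rank as trace. *)
Let tr_xE i : \tr (x * E i) = a i * (\rank (E i))%:R.
Proof.
rewrite -{1}[x](subrK ((a i)%:M)) mulrDl linearD /= -hornerXsubC.
have -> : (a i)%:M * E i = a i *: E i by exact: mul_scalar_mx.
rewrite linearZ /= (mxtrace_idem (E_idem i)).
rewrite (@mxtrace_nilp _ N) ?add0r // exprMn_comm; last by rewrite /GRing.comm E_comm.
by rewrite [E i ^+ _]exprS mulrA -rmorphXn E_mul_eq0 ?mul0r.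
Qed.

Lemma split_nilpotent_of_projectors :
  (forall q p, ad_pair x q p -> \tr (x * horner_mx x q) = 0) -> x ^+ N = 0.
Proof.
(* Only the projectors of nonzero eigenvalues have to vanish; the one for 0 is killed by
   [x ^+ N]. *)
move=> orth; have E0 i : a i != 0 -> E i = 0.
  move=> ai0; have [h _] := rat_embedding K0.
  have [f fi fP] := rational_functional h ai0.
  (* An equality between differences of eigenvalues is a rational relation, so [f] satisfies it as
     well; this makes [gd] below well defined. *)
  have fdiff i1 j1 i2 j2 : a i1 - a j1 = a i2 - a j2 -> f i1 - f j1 = f i2 - f j2.
    pose c t : rat := (t == i1)%:R - (t == j1)%:R - ((t == i2)%:R - (t == j2)%:R).
    have dsum (R : nzRingType) (g : 'I_r -> R) u : \sum_t (t == u)%:R * g t = g u.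
      by rewrite (bigD1 u) //= eqxx mul1r big1 ?addr0 // => t /negPf->; rewrite mul0r.
    move=> aE; apply/eqP; rewrite -subr_eq0; apply/eqP.
    transitivity (\sum_t c t * f t).
      rewrite /c -[in LHS](dsum _ f i1) -[in LHS](dsum _ f j1).
      rewrite -[in LHS](dsum _ f i2) -[in LHS](dsum _ f j2) -!sumrB.
      by apply: eq_bigr => t _; rewrite !mulrBl.
    apply: fP; transitivity (a i1 - a j1 - (a i2 - a j2)); last by rewrite aE subrr.
    rewrite -[in RHS](dsum _ a i1) -[in RHS](dsum _ a j1).
    rewrite -[in RHS](dsum _ a i2) -[in RHS](dsum _ a j2) -!sumrB.
    by apply: eq_bigr => t _; rewrite /c !rmorphB !rmorph_nat -!mulrBl.
  (* [g] and [gd] extend [f] and its differences to all of [K], with the arbitrary value 0 off the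
     eigenvalues and their differences. *)
  pose g c := if [pick t | a t == c] is Some t then h (f t) else 0.
  have gE t : g (a t) = h (f t).
    by rewrite /g; case: pickP => [u /eqP/a_inj->//|/(_ t)]; rewrite eqxx.
  pose gd c := if [pick t : 'I_r * 'I_r | a t.1 - a t.2 == c] is Some t
    then h (f t.1 - f t.2) else 0.
  have gdE t u : gd (a t - a u) = h (f t - f u).
    rewrite /gd; case: pickP => [v /eqP/fdiff->//|/(_ (t, u))] /=.
    by rewrite eqxx.
  have [q qP] := poly_interpolation us g N.
  (* The order is [N + N] because this is the power of [ad x - (a t - a u)] that [iter_ad_eq0] shows
     to kill the block [E t * z * E u]. *)
  have [p pP] := poly_interpolation [seq a t.1 - a t.2 | t : 'I_r * 'I_r] gd (N + N).
  have qE t : horner_mx x q * E t = h (f t) *: E t.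
    by apply: E_eigen; rewrite -gE; apply: qP; exact: mem_nth.
  have pE t u : ('X - (a t - a u)%:P) ^+ (N + N) %| p - (h (f t - f u))%:P.
    by rewrite -gdE; apply: pP; apply/imageP; exists (t, u).
  (* Both sides are linear in [z], so they are compared on the blocks [E t * z * E u], where each
     acts as the scalar [h (f t - f u)]. *)
  have pair_qp : ad_pair x q p.
    have linD (G : {linear 'M[K]_n.+1 -> 'M[K]_n.+1}) z : G z = \sum_t \sum_u G (E t * z * E u).
      rewrite -{1}[z]mul1r -{1}[1 * z]mulr1 -E_sum mulr_suml mulr_suml linear_sum.
      by apply: eq_bigr => t _; rewrite mulr_sumr linear_sum.
    move=> z; pose G : {linear 'M[K]_n.+1 -> 'M[K]_n.+1} := HB.pack (pact p (mx_ad x))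
      (GRing.isLinear.Build _ _ _ _ _ (pact_linear (mx_ad x) p)).
    rewrite [LHS]linD -[RHS]/(G z) [RHS]linD; apply: eq_bigr => t _; apply: eq_bigr => u _ /=.
    set z' := _ * _ * _.
    have -> : mx_ad (horner_mx x q) z' = h (f t - f u) *: z'.
      rewrite /mx_ad /z' rmorphB scalerBl; congr (_ - _).
        by rewrite !mulrA qE -!scalerAl.
      by rewrite -!mulrA E_comm qE -!scalerAr.
    symmetry; apply: pact_eigen (pE t u) _.
    have -> : (fun v => mx_ad x v - (a t - a u) *: v)
       = (fun v => (x - (a t)%:M) * v - v * (x - (a u)%:M)).
      apply: funext => v; rewrite /mx_ad mulrBl mulrBr scalerBl.
      have -> : (a t)%:M * v = a t *: v by exact: mul_scalar_mx.
      have -> : v * (a u)%:M = a u *: v by exact: mul_mx_scalar.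
      by rewrite !opprB addrACA [RHS]addrACA; congr (_ + _); rewrite addrC.
    apply: iter_ad_eq0.
      rewrite -hornerXsubC -rmorphXn /z' !mulrA.
      by rewrite E_mul_eq0 ?mul0r.
    rewrite -hornerXsubC -rmorphXn /z' -!mulrA.
    by rewrite E_comm E_mul_eq0 ?mulr0.
  have tr0 := orth _ _ pair_qp.
  (* The trace of [x * q(x)] is a combination of the [a t] with the rational coefficients
     [f t * rank (E t)]. The property [fP] of [f] turns its vanishing into that of a sum of
     nonnegative rationals [(f t)^2 * rank (E t)]. *)
  have : \sum_t (f t * (\rank (E t))%:R) * f t = 0.
    apply: fP; rewrite -[RHS]tr0 -[X in \tr X]mulr1 -E_sum mulr_sumr linear_sum.
    apply: eq_bigr => t _; rewrite -mulrA qE -scalerAr linearZ /= tr_xE.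
    by rewrite rmorphM rmorph_nat mulrAC mulrA [_ * a t * _]mulrAC.
  move=> /eqP; rewrite psumr_eq0 => [/allP/(_ i)|t _]; last first.
    by rewrite mulrAC mulr_ge0 ?ler0n // -expr2 sqr_ge0.
  rewrite mem_index_enum /= => /(_ isT); rewrite !mulf_eq0 (negPf fi) orbF /=.
  by rewrite pnatr_eq0 mxrank_eq0 => /eqP.
rewrite -[LHS]mulr1 -E_sum mulr_sumr big1 // => i _.
have [ai|/E0->] := eqVneq (a i) 0; last by rewrite mulr0.
rewrite -{1}(horner_mx_X x) -rmorphXn E_mul_eq0 // ai polyC0 subr0 //.
Qed.

End SplitNilpotent.

Lemma split_nilpotent_of_orthogonal (K : fieldType) (K0 : [pchar K] =i pred0) n
    (x : 'M[K]_n.+1) (rs : seq K) : char_poly x %= \prod_(r <- rs) ('X - r%:P) ->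
  (forall q p, ad_pair x q p -> \tr (x * horner_mx x q) = 0) -> x ^+ (size rs).+1 = 0.
Proof.
move=> char_x.
have eP (i : 'I_(size (undup rs))) := cid (poly_interpolation (undup rs)
  (fun c => (c == (undup rs)`_i)%:R) (size rs).+1).
apply: (split_nilpotent_of_projectors K0 char_x (e := fun i => projT1 (eP i))) => i j.
have := projT2 (eP i) _ (mem_nth 0 (ltn_ord j)).
by rewrite nth_uniq ?undup_uniq // polyC_natr.
Qed.

Lemma horner_mx_sum (F : fieldType) n (x : 'M[F]_n.+1) q :
  horner_mx x q = \sum_(i < size q) q`_i *: x ^+ i.
Proof.
rewrite -{1}[q]coefK poly_def linear_sum; apply: eq_bigr => i _.
by rewrite linearZ /= rmorphXn /= horner_mx_X.
Qed.

(** Descent from a splitting field: a nonzero trace over [K] is detected by a [k]-linear functional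
    [phi], and applying [phi] to the coefficients of [q] and [p] gives a pair over [k] that
    contradicts the hypothesis. Orthogonality is thus only assumed over [k]. *)
Lemma nilpotent_of_orthogonal (k : fieldType) (k0 : [pchar k] =i pred0) n (x : 'M[k]_n.+1) :
  (forall q p, ad_pair x q p -> \tr (x * horner_mx x q) = 0) -> exists N, x ^+ N = 0.
Proof.
move=> orth; have [K [iota [sep [rs char_x]]]] :=
  splitting_extension (monic_neq0 (char_poly_monic x)).
rewrite map_char_poly in char_x.
have K0 : [pchar K] =i pred0 by move=> p; rewrite (fmorph_pchar iota).
have mapX i : map_mx iota (x ^+ i) = map_mx iota x ^+ i by rewrite rmorphXn.
exists (size rs).+1; apply/eqP; rewrite -(map_mx_eq0 iota) mapX; apply/eqP.
apply: (split_nilpotent_of_orthogonal K0 char_x) => q p adE.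
set xK := map_mx iota x.
apply/eqP/negPn/negP => /sep[phi [phiZ /eqP[]]].
have phiM c m1 m2 (A : 'M[k]_(m1, m2)) : map_mx phi (c *: map_mx iota A) = phi c *: A.
  by apply/matrixP => i j; rewrite !mxE mulrC phiZ mulrC.
have phi_sum m1 m2 (A : nat -> 'M[k]_(m1, m2)) (u : {poly K}) :
    map_mx phi (\sum_(i < size u) u`_i *: map_mx iota (A i))
    = \sum_(i < size (map_poly phi u)) (map_poly phi u)`_i *: A i.
  rewrite raddf_sum /= (big_ord_widen _ (fun i => (map_poly phi u)`_i *: A i) (size_poly _ _)).
  rewrite [LHS](bigID (fun i : 'I__ => (i < size (map_poly phi u))%N)) /=.
  rewrite [X in _ + X]big1 ?addr0 => [|i].
    by apply: eq_bigr => i _; rewrite phiM coef_map.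
  by rewrite -leqNgt => /leq_sizeP/(_ _ (leqnn i)); rewrite coef_map /= phiM => ->; rewrite scale0r.
have iter_map j z : iter j (mx_ad xK) (map_mx iota z) = map_mx iota (iter j (mx_ad x) z).
  by elim: j => //= j ->; rewrite /mx_ad map_mxB !map_mxM.
have hornerE u : horner_mx xK u = \sum_(i < size u) u`_i *: map_mx iota (x ^+ i).
  by rewrite horner_mx_sum; apply: eq_bigr => i _; rewrite mapX.
have hornerE' : map_mx phi (horner_mx xK q) = horner_mx x (map_poly phi q).
  by rewrite hornerE phi_sum horner_mx_sum.
have traceE (A : 'M[K]_n.+1) : phi (\tr (xK * A)) = \tr (x * map_mx phi A).
  rewrite /mxtrace raddf_sum; apply: eq_bigr => i _; rewrite !mxE raddf_sum.
  by apply: eq_bigr => j _; rewrite !mxE phiZ.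
rewrite traceE hornerE'; apply: orth (map_poly phi p) _ => z.
(* Applying [phi] entrywise to the bracket identity, at matrices coming from [k], gives the identity
   for the image polynomials. *)
have := congr1 (map_mx phi) (adE (map_mx iota z)).
rewrite /pact; under [X in _ = map_mx phi X -> _]eq_bigr do rewrite iter_map.
rewrite phi_sum => <-; apply/matrixP => i j; rewrite -hornerE' !mxE raddfB /= !raddf_sum /=.
congr (_ + _); apply: eq_bigr => l _; rewrite !mxE; first by rewrite mulrC [in RHS]mulrC phiZ.
by rewrite phiZ.
Qed.

(** * Engel's theorem for spaces of matrices *)

Section Engel.
Variables (F : fieldType) (n : nat).
Local Notation A := 'M[F]_n.+1.
Implicit Types (H L : {vspace A}) (x z : A).

(** The expanded bracket consists of products with [a + b] factors from [H] around [z], of which at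
    least [a] stand on the left or at least [b] on the right. *)
Lemma iterated_bracket_eq0 H hs a b z : all (mem H) hs -> size hs = (a + b)%N ->
  (H ^+ a * <[z]> = 0)%VS -> (<[z]> * H ^+ b = 0)%VS ->
  foldl (fun z h => h * z - z * h) z hs = 0.
Proof.
have F0 s : foldl (fun z h : A => h * z - z * h) 0 s = 0.
  by elim: s => //= h s IH; rewrite mulr0 mul0r subr0.
have FB s u v : foldl (fun z h : A => h * z - z * h) (u - v) s
    = foldl (fun z h : A => h * z - z * h) u s - foldl (fun z h : A => h * z - z * h) v s.
  elim: s u v => //= h s IH u v; rewrite -IH; congr foldl.
  by rewrite mulrBr mulrBl !opprB addrACA [RHS]addrACA; congr (_ + _); rewrite addrC.
have line0 z' : (<[z']> = 0)%VS -> z' = 0.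
  by move=> zE; apply/eqP; rewrite -memv0 -zE memv_line.
elim: hs a b z => [|h hs IH] a b z /=.
  by move=> _ /esym/eqP; rewrite addn_eq0 => /andP[/eqP-> _]; rewrite prod1v => /line0.
move=> /andP[hH hsH] sz; case: a sz => [|a] sz.
  by rewrite prod1v => /line0-> _; rewrite mulr0 mul0r subr0 F0.
case: b sz => [|b] sz.
  by rewrite prodv1 => _ /line0->; rewrite mulr0 mul0r subr0 F0.
move=> az zb; rewrite FB.
rewrite (IH a b.+1) ?(IH a.+1 b) ?subr0 //.
- by move: sz; rewrite addSn addnS => -[].
- by apply/eqP; rewrite -subv0 -prodv_line prodvA -[X in (_ <= X)%VS](prod0v <[h]>%VS) -az prodvSl.
- apply/eqP; rewrite -subv0 -prodv_line -prodvA -zb expvSl prodvSr // prodvSl //.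
- by move: sz; rewrite addSn => -[].
- by apply/eqP; rewrite -subv0 -prodv_line prodvA -az expvSr prodvSl // prodvSr.
- by apply/eqP; rewrite -subv0 -prodv_line -prodvA zb prodv0.
Qed.

(** The decreasing spaces [V i = H ^+ i * fullv] are stable under left multiplication by [x], as [x]
    normalizes [H]. Multiplying by [r] factors from [H + <[x]>] sends [V i] into [V i.+1], since
    modulo [V i.+1] only [x ^+ r = 0] could remain; so [N * r] factors give 0. *)
Lemma nilpotent_adjoin H x N r : (H ^+ N = 0)%VS -> x ^+ r = 0 ->
  (forall h, h \in H -> h * x - x * h \in H) -> exists M, ((H + <[x]>) ^+ M = 0)%VS.
Proof.
move=> HN xr nx; pose V i := (H ^+ i * fullv)%VS.
have VS i : V i.+1 = (H * V i)%VS by rewrite /V expvSl prodvA.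
have Vdec i : (V i.+1 <= V i)%VS by rewrite /V expvSr -prodvA prodvSr ?subvf.
have xH : (<[x]> * H <= H * <[x]> + H)%VS.
  apply/prodvP => _ h /vlineP[c ->] hH.
  have -> : c *: x * h = c *: (h * x) - c *: (h * x - x * h).
    by rewrite scalerBr opprB addrC subrK -scalerAl.
  by rewrite memv_add ?memvN ?memvZ ?nx ?memv_mul ?memv_line.
have xV i : (<[x]> * V i <= V i)%VS.
  elim: i => [|i IH]; first by rewrite /V prod1v subvf.
  rewrite VS prodvA (subv_trans (prodvSl _ xH)) // prodvDl subv_add subvv andbT.
  by rewrite -prodvA prodvSr.
have xjV i j : (<[x ^+ j]> * V i <= V i)%VS.
  elim: j => [|j IH]; first by rewrite expr0 prod1v.
  by rewrite exprS -prodv_line -prodvA (subv_trans (prodvSr _ IH)).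
have GV i j : ((H + <[x]>) ^+ j * V i <= V i.+1 + <[x ^+ j]> * V i)%VS.
  elim: j => [|j IH]; first by rewrite expr0 !prod1v addvSr.
  rewrite expvSl -prodvA (subv_trans (prodvSr _ IH)) // prodvDl !prodvDr !subv_add.
  rewrite -VS (subv_trans (Vdec _)) ?addvSl //= VS.
  rewrite (subv_trans (prodvSr _ (xjV i j))) ?addvSl //= -VS.
  rewrite (subv_trans (xV _)) ?addvSl //=.
  by rewrite prodvA prodv_line -exprS addvSr.
have GrV i : ((H + <[x]>) ^+ (i * r) * fullv <= V i)%VS.
  elim: i => [|i IH]; first by rewrite /V mul0n.
  rewrite mulSn expvD -prodvA (subv_trans (prodvSr _ IH)) //.
  by rewrite (subv_trans (GV _ _)) // xr prod0v addv0.
exists (N * r)%N; apply/eqP; rewrite -subv0.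
have := GrV N; rewrite /V HN prod0v; apply: subv_trans.
by rewrite -{1}[(_ ^+ _)%VS]prodv1 prodvSr ?subvf.
Qed.

Theorem engel L : (forall x y, x \in L -> y \in L -> x * y - y * x \in L) ->
  (forall x, x \in L -> exists N, x ^+ N = 0) -> exists N, (L ^+ N = 0)%VS.
Proof.
move=> Lsub Lnil.
pose P m := `[< exists H : {vspace A}, [/\ (H <= L)%VS,
  (forall x y, x \in H -> y \in H -> x * y - y * x \in H),
  (exists N, (H ^+ N = 0)%VS) & \dim H = m] >].
have exP : exists m, P m.
  exists 0%N; apply/asboolP; exists 0%VS; split; rewrite ?sub0v ?dimv0 //.
    by move=> x y; rewrite !memv0 => /eqP-> _; rewrite mul0r mulr0 subr0.
  by exists 1%N; rewrite expv1.
have bP m : P m -> (m <= \dim {:A})%N.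
  by move=> /asboolP[H [_ _ _ <-]]; rewrite dimvS ?subvf.
case: (ex_maxnP exP bP) => m /asboolP[H [HL Hsub [N HN] Hm]] max_m.
have [LH|/subvPn[z zL zH]] := boolP (L <= H)%VS.
  by exists N; apply/eqP; rewrite -subv0 -HN expvS.
(* If no element of [L] outside [H] normalized [H], then [z] could be bracketed with elements of [H]
   forever without entering [H], whereas [N + N] brackets give 0. *)
have [x [xL xH nx]] : exists x, [/\ x \in L, x \notin H & forall h, h \in H -> h * x - x * h \in H].
  apply: contrapT => nex.
  have step y : y \in L -> y \notin H -> exists2 h, h \in H & h * y - y * h \notin H.
    move=> yL yH; apply: contrapT => nh; apply: nex; exists y; split=> // h hH.
    by apply/negPn/negP => bad; apply: nh; exists h.
  have chain j : exists hs, [/\ all (mem H) hs, size hs = j,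
      foldl (fun z h => h * z - z * h) z hs \in L &
      foldl (fun z h => h * z - z * h) z hs \notin H].
    elim: j => [|j [hs [hsH <- wL wH]]]; first by exists [::].
    have [h hH hw] := step _ wL wH; exists (rcons hs h).
    rewrite all_rcons size_rcons !foldl_rcons /= hH hsH; split=> //.
    by apply: Lsub => //; apply: (subvP HL).
  have [hs [hsH sz _ /negP[]]] := chain (N + N)%N.
  rewrite (@iterated_bracket_eq0 H hs N N) ?mem0v //.
    by rewrite HN prod0v.
  by rewrite HN prodv0.
have [r xr] := Lnil x xL; have [M HxM] := nilpotent_adjoin HN xr nx.
(* Adjoining [x] gives a larger subalgebra with a vanishing power, against the maximality of
   [\dim H]. *)
have : (\dim (H + <[x]>) <= m)%N.
  apply: max_m; apply/asboolP; exists (H + <[x]>)%VS; split=> //; last by exists M.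
    by rewrite subv_add HL -memvE.
  move=> _ _ /memv_addP[h1 h1H [_ /vlineP[c1 ->] ->]] /memv_addP[h2 h2H [_ /vlineP[c2 ->] ->]].
  have adC u v : mx_ad u v = - mx_ad v u :> A by rewrite opprB.
  have -> : (h1 + c1 *: x) * (h2 + c2 *: x) - (h2 + c2 *: x) * (h1 + c1 *: x)
     = mx_ad h1 h2 + c2 *: mx_ad h1 x - c1 *: mx_ad h2 x.
    rewrite -[LHS]/(mx_ad _ _) [h2 + _]addrC linearP /= (adC _ x) (adC _ h2).
    have adxx : mx_ad x x = 0 by exact: subrr.
    rewrite ![h1 + _]addrC !linearP /= adxx oppr0 !scaler0 add0r -(adC h1 x) -(adC h1 h2) scalerN.
    by rewrite addrA addrAC [_ + mx_ad h1 h2]addrC.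
  apply: (subvP (addvSl H <[x]>%VS)); apply: memvB; last by rewrite memvZ ?nx.
  by apply: memvD; [exact: Hsub|rewrite memvZ ?nx].
rewrite -Hm => le; have := eqEdim H (H + <[x]>)%VS.
rewrite addvSl le => /eqP HE; case/negP: xH; rewrite HE.
by rewrite (subvP (addvSr H <[x]>%VS)) ?memv_line.
Qed.

End Engel.

(** * Cartan's criterion *)

Section LinearMaps.
Variables (k : fieldType) (V : vectType k).

Definition linmap (W : vectType k) (f : V -> W) (fL : linear f) : 'Hom(V, W) :=
  linfun (HB.pack_for {linear V -> W} f (GRing.isLinear.Build k V W _ f fL)).

Lemma linmapE (W : vectType k) (f : V -> W) (fL : linear f) x : linmap fL x = f x.
Proof. by rewrite lfunE. Qed.

End LinearMaps.

Section EndTrace.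
Variables (k : fieldType) (V : vectType k).

Lemma f2mx_linear : linear (@f2mx k V V).
Proof.
move=> a f g; apply/row_matrixP => i; rewrite linearP /= !rowE.
have fE (h : 'End(V)) : delta_mx 0 i *m f2mx h = v2r (h (r2v (delta_mx 0 i))).
  by rewrite /fun_of_lfun unlock /= r2vK r2vK.
by rewrite !fE add_lfunE scale_lfunE linearP.
Qed.

Lemma f2mxB (f g : 'End(V)) : f2mx (f - g) = f2mx f - f2mx g.
Proof. by rewrite -!(linmapE f2mx_linear) linearB. Qed.

Lemma f2mx_eq0 (f : 'End(V)) : f2mx f = 0 -> f = 0.
Proof.
move=> f0; have : f2mx f = f2mx (f - f) by rewrite f2mxB subrr.
by rewrite subrr; case: f f0 => A _ /=; case: (0 : 'End(V)) => B /= ->.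
Qed.

Lemma f2mx_comp (f g : 'End(V)) : f2mx (f \o g)%VF = f2mx g *m f2mx f.
Proof.
have <- : Hom (f2mx g *m f2mx f) = (f \o g)%VF; last by [].
apply/lfunP => x; rewrite comp_lfunE /fun_of_lfun unlock /=.
by rewrite /fun_of_lfun_def /= r2vK mulmxA.
Qed.

Definition lftrace (f : 'End(V)) : k := \tr (f2mx f).

Lemma lftrace_linear : linear (lftrace : 'End(V) -> k^o).
Proof. by move=> a f g; rewrite /lftrace f2mx_linear linearP. Qed.

Lemma lftraceB (f g : 'End(V)) : lftrace (f - g) = lftrace f - lftrace g.
Proof. by rewrite -!(linmapE lftrace_linear) linearB. Qed.

Lemma lftraceC (f g : 'End(V)) : lftrace (f \o g) = lftrace (g \o f).
Proof. by rewrite /lftrace !f2mx_comp mxtrace_mulC. Qed.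

End EndTrace.

Section LieSpaces.
Variables (k : fieldType) (L : vectLieType k).
Implicit Types (x y : L) (U V W : {vspace L}).

Lemma lie_sumr I (r : seq I) (P : pred I) x (F : I -> L) :
  lie x (\sum_(i <- r | P i) F i) = \sum_(i <- r | P i) lie x (F i).
Proof.
by elim/big_rec2: _ => [|i u v _ <-]; [exact: lie0r|rewrite lieDr].
Qed.

Lemma lie_suml I (r : seq I) (P : pred I) x (F : I -> L) :
  lie (\sum_(i <- r | P i) F i) x = \sum_(i <- r | P i) lie (F i) x.
Proof.
by elim/big_rec2: _ => [|i u v _ <-]; [exact: lie0l|rewrite lieDl].
Qed.

Lemma memv_liev U V x y : x \in U -> y \in V -> lie x y \in liev U V.
Proof.
move=> xU yV; rewrite (coord_vbasis xU) (coord_vbasis yV) lie_suml memv_suml // => i _.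
rewrite lie_sumr memv_suml // => j _; rewrite lieZl lieZr !memvZ // memv_span //.
by apply/allpairsP; exists ((vbasis U)`_i, (vbasis V)`_j); rewrite !mem_nth ?size_tuple.
Qed.

Lemma lievP U V W : (forall x y, x \in U -> y \in V -> lie x y \in W) -> (liev U V <= W)%VS.
Proof.
move=> H; apply/span_subvP => _ /allpairsP[[u v] /= [uU vV ->]].
by apply: H; exact: vbasis_mem.
Qed.

Lemma lievS U U' V V' : (U <= U')%VS -> (V <= V')%VS -> (liev U V <= liev U' V')%VS.
Proof.
by move=> UU VV; apply: lievP => x y xU yV; rewrite memv_liev ?(subvP UU) ?(subvP VV).
Qed.

Lemma lie_idealC U x y : lie_ideal_closed U -> x \in U -> lie x y \in U.
Proof. by move=> Ui xU; rewrite lieC memvN Ui. Qed.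

Lemma jacobi_lie x y z : lie (lie x y) z = lie x (lie y z) - lie y (lie x z).
Proof.
have := lie_jacobi x y z; rewrite (lieC z (lie x y)) => /eqP.
by rewrite subr_eq0 (lieC z x) -[- lie x z]scaleN1r lieZr scaleN1r => /eqP<-.
Qed.

End LieSpaces.

Section Adjoint.
Variables (k : fieldType) (L : vectLieType k).
Implicit Types (x y : L) (U V : {vspace L}).

Fact lie_linear x : linear (lie x).
Proof. by move=> a y z; rewrite lieDr lieZr. Qed.

Definition lie_ad x : 'End(L) := linmap (lie_linear x).

Lemma lie_adE x y : lie_ad x y = lie x y.
Proof. exact: linmapE. Qed.

Lemma lie_ad_representation : representation lie_ad.
Proof.
split=> [a x y|x y]; apply/lfunP => z.
  by rewrite add_lfunE scale_lfunE !lie_adE lieDl lieZl.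
by rewrite add_lfunE opp_lfunE !comp_lfunE !lie_adE jacobi_lie.
Qed.

Lemma lie_leibniz x y z : lie x (lie y z) = lie (lie x y) z + lie y (lie x z).
Proof. by rewrite jacobi_lie subrK. Qed.

Lemma liev_ideal U V : lie_ideal_closed U -> lie_ideal_closed V ->
  lie_ideal_closed (liev U V).
Proof.
move=> Ui Vi x y yUV; have /subvP/(_ y yUV) : (liev U V <= lie_ad x @^-1: liev U V)%VS.
  apply: lievP => u v uU vV; rewrite -memv_preim lie_adE lie_leibniz.
  by apply: memvD; apply: memv_liev => //; [exact: Ui|exact: Vi].
by rewrite -memv_preim lie_adE.
Qed.

Lemma liev_sub_ideal U : lie_ideal_closed U -> (liev U U <= U)%VS.
Proof. by move=> Ui; apply: lievP => x y _; exact: Ui. Qed.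

Lemma derived_series_ideal U i : lie_ideal_closed U -> lie_ideal_closed (derived_series U i).
Proof. by move=> Ui; elim: i => //= i IH; exact: liev_ideal. Qed.

Lemma derived_series_sub U i : lie_ideal_closed U -> (derived_series U i <= U)%VS.
Proof.
move=> Ui; elim: i => //= i; apply: subv_trans.
by apply: liev_sub_ideal; exact: derived_series_ideal.
Qed.

End Adjoint.

Section Cartan.
Variables (k : fieldType) (k0 : [pchar k] =i pred0) (S : vectLieType k).
Implicit Types (x y u v : S) (U : {vspace S}).

(* f2mx reverses composition, whence the antihomomorphism. *)
Lemma cartan_mx n (R : S -> 'M[k]_n) U : linear R ->
  (forall x y, R (lie x y) = R y *m R x - R x *m R y) -> lie_ideal_closed U ->
  (forall x y, x \in U -> y \in U -> \tr (R x *m R y) = 0) ->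
  exists j, forall x, x \in derived_series U j -> R x = 0.
Proof.
case: n R => [|n] R Rlin Rlie Ui Utr.
  by exists 0%N => x _; apply/matrixP => [[]].
have Di := liev_ideal Ui Ui.
have R0 : R 0 = 0 by rewrite -(linmapE Rlin) linear0.
have adR x y : mx_ad (R x) (R y) = R (lie y x) by rewrite Rlie.
(* As [U] is an ideal, its image is preserved by [mx_ad (R x)] and by polynomials in it. *)
have actR p x y : y \in U -> exists2 w, w \in U & pact p (mx_ad (R x)) (R y) = R w.
  move=> yU; have iterR j : exists2 w, w \in U & iter j (mx_ad (R x)) (R y) = R w.
    elim: j => [|j [w wU IH]]; first by exists y.
    by exists (lie w x); [exact: lie_idealC|rewrite /= IH adR].
  rewrite /pact; elim/big_rec: _ => [|i z _ [w wU ->]].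
    by exists 0; [exact: mem0v|rewrite R0].
  have [v vU ->] := iterR i; exists (p`_i *: v + w); last by rewrite Rlin.
  by rewrite memvD ?memvZ.
have Rnil x : x \in liev U U -> exists N, R x ^+ N = 0.
  move=> xD; apply: (nilpotent_of_orthogonal k0) => q p qp.
  set Y := horner_mx (R x) q in qp *.
  have trlin : linear ((fun u => \tr (R u * Y)) : S -> k^o).
    by move=> a u v; rewrite Rlin mulrDl -scalerAl linearP.
  have /subvP/(_ x xD) : (liev U U <= lker (linmap trlin))%VS.
    (* Cyclicity of the trace moves the bracket of [u] and [v] to one of [R v] with [Y], which by
       [ad_pair] is [R w] for some [w] in [U]. *)
    apply: lievP => u v uU vU; rewrite memv_ker linmapE Rlie mulrBl linearB /=.
    have [w wU] := actR p x v vU; rewrite -qp => wE.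
    have := Utr _ _ uU wU; rewrite -wE mulmxBr linearB /= => <-.
    by rewrite -!mulmxE !mulmxA -(mulmxA (R v)) mxtrace_mulC.
  by rewrite memv_ker linmapE => /eqP.
have [|y /memv_imgP[v vD ->]|N LN] := @engel k n (linmap Rlin @: liev U U)%VS.
- move=> _ _ /memv_imgP[u uD ->] /memv_imgP[v vD ->].
  rewrite !linmapE -[_ - _]/(mx_ad _ _) adR -(linmapE Rlin) memv_img //; exact: Di.
- by rewrite linmapE; exact: Rnil.
(* The [N.+1]-st derived term maps into the [N.+1]-st power of the image of [liev U U], which is 0;
   the successor lets the induction start at the first power. *)
exists N.+1 => x xD; apply/eqP; rewrite -memv0.
have -> : 0%VS = ((linmap Rlin @: liev U U) ^+ N.+1)%VS by rewrite expvSl LN prodv0.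
elim: N {LN} x xD => [|N IH] x.
  by rewrite expv1 -(linmapE Rlin) => xD; rewrite memv_img.
set E := derived_series U N.+1 in IH *; rewrite -(linmapE Rlin) => xE.
have ED : (E <= liev U U)%VS.
  by rewrite /E; apply: lievS; exact: derived_series_sub.
suff /subvP/(_ x xE) : (liev E E <= linmap Rlin @^-1: ((linmap Rlin @: liev U U) ^+ N.+2))%VS.
  by rewrite -memv_preim.
apply: lievP => u v uE vE; rewrite -memv_preim linmapE Rlie.
have RD w : w \in E -> R w \in (linmap Rlin @: liev U U)%VS.
  by move=> wE; rewrite -(linmapE Rlin) memv_img // (subvP ED).
by rewrite expvSl; apply: memvB; apply: memv_mul; rewrite ?RD ?IH.
Qed.

End Cartan.

Section TraceForm.
Variables (k : fieldType) (S : vectLieType k) (V : vectType k) (rho : S -> 'End(V)).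
Hypothesis rep : representation rho.
Implicit Types (x y z : S) (U : {vspace S}).

Definition trform x y : k := lftrace (rho x \o rho y).

Let rhoL : linear rho. Proof. by case: rep. Qed.
Let rhoM x y : rho (lie x y) = (rho x \o rho y)%VF - (rho y \o rho x)%VF.
Proof. by case: rep. Qed.

Lemma trformC x y : trform x y = trform y x.
Proof. exact: lftraceC. Qed.

Lemma trform_linear y : linear ((fun x => trform x y) : S -> k^o).
Proof.
move=> a x z; rewrite /trform rhoL comp_lfunDl -comp_lfunZl.
exact: lftrace_linear.
Qed.

Lemma trformN x y : trform (- x) y = - trform x y.
Proof. by rewrite -[LHS](linmapE (trform_linear y)) linearN /= linmapE. Qed.

Lemma trformZ a x y : trform (a *: x) y = a * trform x y.
Proof. by rewrite -[LHS](linmapE (trform_linear y)) linearZ /= linmapE. Qed.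

Lemma trformB x y z : trform (x - y) z = trform x z - trform y z.
Proof. by rewrite -[LHS](linmapE (trform_linear z)) linearB /= !linmapE. Qed.

Lemma trform_sum I (r : seq I) (P : pred I) (F : I -> S) y :
  trform (\sum_(i <- r | P i) F i) y = \sum_(i <- r | P i) trform (F i) y.
Proof.
rewrite -[LHS](linmapE (trform_linear y)) linear_sum.
by apply: eq_bigr => i _ /=; rewrite linmapE.
Qed.

Lemma trform_invariant x y z : trform (lie x y) z = trform x (lie y z).
Proof.
rewrite /trform !rhoM comp_lfunDl comp_lfunDr comp_lfunNl comp_lfunNr !lftraceB.
by rewrite comp_lfunA; congr (_ - _); rewrite -comp_lfunA lftraceC comp_lfunA.
Qed.

Definition perp U : {vspace S} :=
  (\bigcap_(i < \dim U) lker (linmap (trform_linear (vbasis U)`_i)))%VS.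

Lemma memv_perp U x : reflect (forall y, y \in U -> trform x y = 0) (x \in perp U).
Proof.
have memP : reflect (forall i : 'I_(\dim U), trform x (vbasis U)`_i = 0) (x \in perp U).
  rewrite memvE; apply: (iffP subv_bigcapP) => H i => [|_].
    by have := H i isT; rewrite -memvE memv_ker linmapE => /eqP.
  by rewrite -memvE memv_ker linmapE H.
apply: (iffP memP) => H => [y yU|i]; last by rewrite H // vbasis_mem // mem_nth ?size_tuple.
rewrite (coord_vbasis yU) trformC trform_sum big1 // => i _.
by rewrite trformZ trformC H mulr0.
Qed.

Lemma perp_ideal U : lie_ideal_closed U -> lie_ideal_closed (perp U).
Proof.
move=> Ui x y /memv_perp yU; apply/memv_perp => z zU.
by rewrite lieC trformN trform_invariant yU ?oppr0 // Ui.
Qed.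

Lemma dim_perp U : (\dim {:S} <= \dim U + \dim (perp U))%N.
Proof.
pose f x : 'rV[k]_(\dim U) := \row_i trform x (vbasis U)`_i.
have fL : linear f.
  by move=> a x y; apply/rowP => i; rewrite !mxE; exact: trform_linear.
have -> : perp U = lker (linmap fL).
  apply/vspaceP => x; rewrite memv_ker linmapE; apply/memv_perp/eqP => [H|fx y yU].
    by apply/rowP => i; rewrite !mxE H // vbasis_mem // mem_nth ?size_tuple.
  rewrite (coord_vbasis yU) trformC trform_sum big1 // => i _.
  by have /rowP/(_ i) := fx; rewrite !mxE trformZ trformC => ->; rewrite mulr0.
rewrite -(limg_ker_dim (linmap fL) fullv) capfv addnC leq_add2r.
by rewrite (leq_trans (dimvS (subvf _))) // dimvf /dim /= mul1n.
Qed.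

Definition rep_ker : {vspace S} := lker (linmap (proj1 rep)).

Lemma memv_rep_ker x : (x \in rep_ker) = (rho x == 0).
Proof. by rewrite memv_ker linmapE. Qed.

Lemma rep_ker_ideal : lie_ideal_closed rep_ker.
Proof.
move=> x y; rewrite !memv_rep_ker rhoM => /eqP->.
by rewrite comp_lfun0l comp_lfun0r subrr.
Qed.

Hypothesis k0 : [pchar k] =i pred0.

Lemma cartan U : lie_ideal_closed U ->
  (forall x y, x \in U -> y \in U -> trform x y = 0) ->
  exists j, forall x, x \in derived_series U j -> rho x = 0.
Proof.
move=> Ui Utr.
have RL : linear (fun x => f2mx (rho x)).
  by move=> a x y; rewrite rhoL f2mx_linear.
have [||j jP] := cartan_mx k0 RL _ Ui.
- by move=> x y; rewrite rhoM -!f2mx_comp f2mxB.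
- by move=> x y xU yU; rewrite -f2mx_comp -[\tr _]/(trform y x) Utr.
by exists j => x /jP/f2mx_eq0.
Qed.

End TraceForm.

Section Semisimple.
Variables (k : fieldType) (k0 : [pchar k] =i pred0) (S : vectLieType k).
Hypothesis ss : semisimple S.
Implicit Types (x y z : S) (U : {vspace S}).

Local Notation adrep := (@lie_ad_representation k S).
Local Notation killing_perp := (perp adrep).

(** By Cartan's criterion for [lie_ad] some derived term of [U] is central, so the next one is 0 and
    [U] is a solvable ideal. *)
Lemma killing_null_ideal U : lie_ideal_closed U ->
  (forall x y, x \in U -> y \in U -> trform (@lie_ad k S) x y = 0) -> U = 0%VS.
Proof.
move=> Ui U0; apply: ss => //; have [j jP] := cartan adrep k0 Ui U0.
exists j.+1; apply/eqP; rewrite -subv0; apply: lievP => x y /jP ad0 _.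
by rewrite -lie_adE ad0 zero_lfunE mem0v.
Qed.

(** The intersection is an ideal on which the Killing form vanishes, and the orthogonal has at least
    the complementary dimension. *)
Lemma killing_complement U : lie_ideal_closed U ->
  (U :&: killing_perp U = 0)%VS /\ (U + killing_perp U = fullv)%VS.
Proof.
move=> Ui; have Pi := perp_ideal (rep := adrep) Ui.
have cap0 : (U :&: killing_perp U = 0)%VS.
  apply: killing_null_ideal => [x y|x y]; rewrite !memv_cap.
    by move=> /andP[yU yP]; rewrite Ui ?Pi.
  by move=> /andP[_ /memv_perp xP] /andP[yU _]; exact: xP.
split=> //; apply/eqP; rewrite eqEdim subvf /=.
by rewrite (leq_trans (dim_perp adrep U)) // -dimv_sum_cap cap0 dimv0 addn0.
Qed.

(** Brackets within the Killing complement of [[S, S]] lie in both summands, so this complement is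
    an abelian ideal and vanishes. *)
Lemma semisimple_perfect : liev fullv fullv = fullv :> {vspace S}.
Proof.
have Fi : lie_ideal_closed (fullv : {vspace S}) by move=> x y _; exact: memvf.
have Di := liev_ideal Fi Fi; set D := liev _ _ in Di *.
have [cap0 <-] := killing_complement Di.
rewrite (_ : killing_perp D = 0%VS) ?addv0 //; apply: ss.
  exact: perp_ideal.
exists 1%N; apply/eqP; rewrite -subv0 -cap0 subv_cap; apply/andP; split.
  by apply: lievS; exact: subvf.
exact/liev_sub_ideal/perp_ideal.
Qed.

End Semisimple.

(** * The Casimir element and complete reducibility *)

Section Casimir.
Variables (k : fieldType) (k0 : [pchar k] =i pred0) (S : vectLieType k).
Hypothesis ss : semisimple S.
Variables (V : vectType k) (rho : S -> 'End(V)) (rep : representation rho).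
Implicit Types (x y z : S).

(** A complement of the kernel of [rho], hence an ideal on which [rho] is faithful. *)
Let T : {vspace S} := perp (@lie_ad_representation k S) (rep_ker rep).
Let B := trform rho.

Let T_ideal : lie_ideal_closed T.
Proof. exact/perp_ideal/rep_ker_ideal. Qed.

(** The radical of the form on [T] is an ideal. Cartan's criterion puts one of its derived terms
    into the kernel of [rho], which meets [T] in 0, so the radical is solvable and therefore 0. *)
Let T_nondegenerate x : x \in T -> (forall y, y \in T -> B x y = 0) -> x = 0.
Proof.
move=> xT xB; pose R := (T :&: perp rep T)%VS.
have Ri : lie_ideal_closed R.
  move=> y z; rewrite !memv_cap => /andP[zT zP].
  by rewrite T_ideal // perp_ideal.
suff R0 : R = 0%VS by apply/eqP; rewrite -memv0 -R0 memv_cap xT; apply/memv_perp.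
apply: ss => //; have [y z|j jP] := cartan rep k0 Ri.
  by rewrite !memv_cap => /andP[_ /memv_perp yP] /andP[zT _]; exact: yP.
exists j; apply/eqP; rewrite -subv0.
have [<- _] := killing_complement k0 ss (@rep_ker_ideal _ _ _ _ rep).
rewrite subv_cap; apply/andP; split.
  by apply/subvP => y /jP y0; rewrite memv_rep_ker y0.
apply: subv_trans (derived_series_sub _ Ri) _; exact: capvSl.
Qed.

(** The [b i] and [c i] are dual bases of [T]. The last clause is the invariance of the sum of the
    tensors of [b i] and [c i], tested against all bilinear maps so that no tensor product is
    formed; it serves both for the Casimir operator and for cocycles. *)
Lemma casimir_basis : exists r (b c : 'I_r -> S),
  [/\ r = 0%N -> forall x, rho x = 0,
    forall i, trform rho (b i) (c i) = 1 &
  forall (W : lmodType k) (beta : S -> S -> W),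
    (forall y, linear (beta^~ y)) -> (forall x, linear (beta x)) ->
  forall x, \sum_i (beta (lie x (b i)) (c i) + beta (b i) (lie x (c i))) = 0].
Proof.
pose b (i : 'I_(\dim T)) := (vbasis T)`_i.
have bT i : b i \in T by rewrite vbasis_mem // mem_nth ?size_tuple.
have bfree : free (vbasis T) := basis_free (vbasisP T).
pose G := \matrix_(i, j) B (b i) (b j).
(* A row killed by the Gram matrix gives an element of [T] orthogonal to [T]. *)
have Gu : G \in unitmx.
  rewrite -row_free_unit; apply/row_freeP; exists (invmx G); apply: mulmxV.
  rewrite -row_free_unit -kermx_eq0; apply/eqP/row_matrixP => i; rewrite row0.
  set u := row i _; have uG : u *m G = 0 by rewrite -row_mul mulmx_ker row0.
  have x0 : \sum_j u 0 j *: b j = 0.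
    apply: T_nondegenerate => [|y yT].
      by apply: memv_suml => j _; rewrite memvZ.
    rewrite (coord_vbasis yT) /B trformC trform_sum // big1 // => j _.
    rewrite trformZ //.
    have -> : trform rho (vbasis T)`_j (\sum_l u 0 l *: b l) = (u *m G) 0 j.
      by rewrite trformC trform_sum // mxE; apply: eq_bigr => l _; rewrite trformZ // [G _ _]mxE.
    by rewrite uG mxE mulr0.
  move/freeP: bfree => /(_ (fun j => u 0 j)) bfree.
  by apply/rowP => j; rewrite [RHS]mxE; exact: bfree x0 j.
pose c i := \sum_j invmx G i j *: b j.
have cT i : c i \in T by apply: memv_suml => j _; rewrite memvZ.
have Bcb i j : B (c i) (b j) = (i == j)%:R.
  have /matrixP/(_ i j) := mulVmx Gu; rewrite !mxE => <-.
  by rewrite /B trform_sum //; apply: eq_bigr => l _; rewrite trformZ // mxE.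
have expb z : z \in T -> z = \sum_i B (c i) z *: b i.
  move=> zT; rewrite {1}(coord_vbasis zT); apply: eq_bigr => i _; congr (_ *: _).
  rewrite /B trformC {2}(coord_vbasis zT) trform_sum // (bigD1 i) //= big1 ?addr0 => [|j ji].
    by rewrite trformZ // trformC [trform _ (c _) (b _)]Bcb eqxx mulr1.
  by rewrite trformZ // trformC [trform _ (c _) (b _)]Bcb eq_sym (negPf ji) mulr0.
have expc z : z \in T -> z = \sum_i B z (b i) *: c i.
  move=> zT; apply/eqP; rewrite -subr_eq0; apply/eqP; apply: T_nondegenerate => [|y yT].
    by rewrite memvB // memv_suml // => i _; rewrite memvZ.
  have orth j : B (z - \sum_i B z (b i) *: c i) (b j) = 0.
    rewrite /B trformB // trform_sum // (bigD1 j) //= big1 => [|i ij].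
      by rewrite trformZ // [trform _ (c _) _]Bcb eqxx mulr1 addr0 subrr.
    by rewrite trformZ // [trform _ (c _) _]Bcb (negPf ij) mulr0.
  rewrite (coord_vbasis yT) /B trformC trform_sum // big1 // => j _.
  by rewrite trformZ // trformC [trform _ _ _]orth mulr0.
exists (\dim T), b, c; split=> [/eqP T0 x|i|W beta betaL betaR x].
- have [_ /vspaceP/(_ x)] := killing_complement k0 ss (@rep_ker_ideal _ _ _ _ rep).
  by move: T0; rewrite dimv_eq0 => /eqP; rewrite /T => ->; rewrite addv0 memvf memv_rep_ker => /eqP.
- by rewrite /B trformC [trform _ (c _) (b _)]Bcb eqxx.
have sumL y (I : finType) (a : I -> k) (F : I -> S) :
    beta (\sum_i a i *: F i) y = \sum_i a i *: beta (F i) y.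
  pose f : {linear S -> W} := HB.pack (beta^~ y) (GRing.isLinear.Build k S W _ _ (betaL y)).
  by rewrite -[LHS]/(f _) linear_sum; apply: eq_bigr => i _; rewrite linearZ.
have sumR y (I : finType) (a : I -> k) (F : I -> S) :
    beta y (\sum_i a i *: F i) = \sum_i a i *: beta y (F i).
  pose f : {linear S -> W} := HB.pack (beta y) (GRing.isLinear.Build k S W _ _ (betaR y)).
  by rewrite -[LHS]/(f _) linear_sum; apply: eq_bigr => i _; rewrite linearZ.
rewrite big_split /=.
(* Expand [lie x (b i)] in the [b j] and [lie x (c i)] in the [c j]. After the two sums are
   exchanged in the second expression, invariance of the form makes the coefficients opposite. *)
have -> : \sum_i beta (lie x (b i)) (c i) =
    \sum_i \sum_j B (c j) (lie x (b i)) *: beta (b j) (c i).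
  by apply: eq_bigr => i _; rewrite {1}[lie x (b i)]expb ?sumL // T_ideal.
have -> : \sum_i beta (b i) (lie x (c i)) =
    \sum_i \sum_j B (lie x (c j)) (b i) *: beta (b j) (c i).
  rewrite exchange_big; apply: eq_bigr => i _ /=.
  by rewrite {1}[lie x (c i)]expc ?sumR // T_ideal.
rewrite -big_split big1 // => i _; rewrite -big_split big1 // => j _ /=.
by rewrite -scalerDl (lieC x (c j)) /B trformN // trform_invariant // subrr scale0r.
Qed.

End Casimir.

Section WhiteheadLemma.
Variables (k : fieldType) (k0 : [pchar k] =i pred0) (S : vectLieType k).
Hypothesis ss : semisimple S.

Definition cocycle (V : vectType k) (rho : S -> 'End(V)) (delta : S -> V) :=
  linear delta /\ forall x y, delta (lie x y) = rho x (delta y) - rho y (delta x).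

(** Turns [delta] into a cocycle of the subrepresentation on [U], where a vanishing result may be
    available: the induction hypothesis in [whitehead], and [whitehead] itself in
    [stable_complement]. *)
Lemma cocycle_restrict (V : vectType k) (rho : S -> 'End(V)) (U : {vspace V}) delta :
  (forall (rho' : S -> 'End(subvs_of U)) delta', representation rho' ->
     cocycle rho' delta' -> exists m, forall x, delta' x = rho' x m) ->
  representation rho -> stable rho (mem U) -> cocycle rho delta ->
  (forall x, delta x \in U) -> exists2 m, m \in U & forall x, delta x = rho x m.
Proof.
move=> H [rhoL rhoM] rhoU [dL dM] dU.
have rL x : linear (fun u : subvs_of U => vsproj U (rho x (vsval u))).
  by move=> a u v; rewrite !linearP.
have rE x u : vsval (linmap (rL x) u) = rho x (vsval u).
  by rewrite linmapE vsprojK // rhoU // subvsP.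
have dE x : vsval (vsproj U (delta x)) = delta x by rewrite vsprojK.
have [||m mE] := H (fun x => linmap (rL x)) (fun x => vsproj U (delta x)).
- split=> [a x y|x y]; apply/lfunP => u; apply: subvs_inj.
    by rewrite rE rhoL !add_lfunE !scale_lfunE linearP /= !rE.
  by rewrite rE rhoM !add_lfunE !opp_lfunE !comp_lfunE linearB /= !rE.
- split=> [a x y|x y]; first by rewrite dL linearP.
  by apply: subvs_inj; rewrite dE dM linearB /= !rE !dE.
exists (vsval m) => [|x]; first exact: subvsP.
by rewrite -rE -mE dE.
Qed.

Theorem whitehead (V : vectType k) (rho : S -> 'End(V)) delta : representation rho ->
  cocycle rho delta -> exists m, forall x, delta x = rho x m.
Proof.
have [n] := ubnP (\dim {:V}); elim: n V rho delta => // n IH V rho delta.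
rewrite ltnS => Vn rep [dL dM]; have [rhoL rhoM] := rep.
have [r [b [c [r0 bc inv]]]] := casimir_basis k0 ss rep.
have rho_lie x y v : rho (lie x y) v = rho x (rho y v) - rho y (rho x v).
  by rewrite rhoM add_lfunE opp_lfunE !comp_lfunE.
pose Gam := \sum_i (rho (b i) \o rho (c i))%VF.
have GamE v : Gam v = \sum_i rho (b i) (rho (c i) v).
  by rewrite sum_lfunE; apply: eq_bigr => i _; rewrite comp_lfunE.
have trG : lftrace Gam = r%:R.
  rewrite -(linmapE (@lftrace_linear k V)) linear_sum -[r in RHS]card_ord -sumr_const.
  by apply: eq_bigr => i _; rewrite /= linmapE; exact: bc.
(* [inv] is applied to [rho y (rho z v)] here and to [rho y (delta z)] in [homotopy], where the
   cocycle identity supplies the second summand. *)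
have Gcomm x v : rho x (Gam v) = Gam (rho x v).
  apply/eqP; rewrite -subr_eq0 !GamE linear_sum -sumrB; apply/eqP.
  rewrite -[RHS](inv V (fun y z => rho y (rho z v)) _ _ x).
  - by apply: eq_bigr => i _ /=; rewrite !rho_lie linearB /= addrA subrK.
  - by move=> y a u w; rewrite rhoL add_lfunE scale_lfunE.
  - by move=> y a u w; rewrite rhoL add_lfunE scale_lfunE linearP.
pose m0 := \sum_i rho (b i) (delta (c i)).
have homotopy x : rho x m0 = Gam (delta x).
  apply/eqP; rewrite -subr_eq0 GamE linear_sum -sumrB; apply/eqP.
  rewrite -[RHS](inv V (fun y z => rho y (delta z)) _ _ x).
  - by apply: eq_bigr => i _ /=; rewrite rho_lie dM linearB /= addrA subrK.
  - by move=> y a u w; rewrite rhoL add_lfunE scale_lfunE.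
  - by move=> y a u w; rewrite dL linearP.
(* For [r = 0] the representation is zero, so [delta] kills all brackets, and these span [S]. *)
have [/eqP/r0 rho0|rn0] := boolP (r == 0%N).
  exists 0 => x; rewrite linear0.
  have : (fullv <= lker (linmap dL))%VS.
    rewrite -(semisimple_perfect k0 ss); apply: lievP => y z _ _.
    by rewrite memv_ker linmapE dM !rho0 !zero_lfunE subrr.
  by move=> /subvP/(_ x (memvf x)); rewrite memv_ker linmapE => /eqP.
pose G j : 'End(V) := iter j (comp_lfun Gam) \1%VF.
have GE j v : G j v = iter j Gam v.
  by elim: j => [|j IHj] /=; rewrite ?id_lfunE // comp_lfunE IHj.
(* Choosing a power of [Gam] whose kernel has largest dimension makes kernel and image stay the same
   at the next power, as the Fitting decomposition needs. *)
pose P d := `[< exists j, \dim (lker (G j)) = d >].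
have exP : exists d, P d by exists (\dim (lker (G 0))); apply/asboolP; exists 0%N.
have bP d : P d -> (d <= \dim {:V})%N by move=> /asboolP[j <-]; rewrite dimvS ?subvf.
case: (ex_maxnP exP bP) => d /asboolP[j dj] max_d.
have kerS : lker (G j) = lker (G j.+1).
  apply/eqP; rewrite eqEdim dj max_d ?andbT; last by apply/asboolP; exists j.+1.
  by apply/subvP => v; rewrite !memv_ker !GE /= => /eqP->; rewrite linear0.
have kerE v : iter j.+1 Gam v = 0 -> v \in lker (G j).
  by move=> v0; rewrite kerS memv_ker GE v0.
have imgS : limg (G j) = limg (G j.+1).
  apply/eqP; rewrite eq_sym eqEdim; apply/andP; split.
    by apply/subvP => _ /memv_imgP[v _ ->]; rewrite GE iterSr -GE memv_img ?memvf.
  rewrite -(leq_add2l (\dim (fullv :&: lker (G j)))) limg_ker_dim kerS.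
  by rewrite limg_ker_dim.
have fitting v : exists w, v - Gam w \in lker (G j).
  have : G j v \in limg (G j.+1) by rewrite -imgS memv_img ?memvf.
  by move=> /memv_imgP[w _ Gvw]; exists w; rewrite memv_ker linearB /= Gvw !GE -iterSr subrr.
(* Otherwise [Gam] is nilpotent of trace 0, but its trace is [r], which is nonzero in characteristic
   zero. *)
have properU : (\dim (lker (G j)) < \dim {:V})%N.
  rewrite ltn_neqAle dimvS ?subvf // andbT; apply: contraNneq rn0 => dimU.
  have kerT : lker (G j) = fullv by apply/eqP; rewrite eqEdim subvf dimU /=.
  have f2mxG i (h : 'End(V)) : f2mx (iter i (comp_lfun Gam) h)
      = f2mx h *m f2mx Gam ^+ i.
    elim: i => [|i IHi] /=; first by rewrite expr0 mulmx1.
    by rewrite f2mx_comp IHi exprSr -!mulmxE mulmxA.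
  have : iter j (comp_lfun Gam) Gam = 0.
    apply/lfunP => v; rewrite zero_lfunE; have := memvf (Gam v).
    rewrite -kerT memv_ker => /eqP; rewrite GE => <-.
    by elim: (j) => [|i IHi] //=; rewrite comp_lfunE IHi.
  move=> /(congr1 (@f2mx _ _ _)); rewrite f2mxG.
  rewrite -[X in _ = f2mx X](subrr Gam) f2mxB subrr.
  move=> nil; have := @mxtrace_nilp _ j.+1 (dim V) (f2mx Gam).
  rewrite exprS -mulmxE nil => /(_ erefl); rewrite -[\tr _]/(lftrace Gam) trG => /eqP.
  by rewrite ((pcharf0P k).1 k0).
(* By [homotopy], [Gam (delta x - rho x m) = rho x (m0 - Gam m)] lies in [lker (G j)]. So the
   corrected cocycle takes its values in this proper stable subspace, where induction applies. *)
have [m mU] := fitting m0.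
have iter_rho i x v : iter i Gam (rho x v) = rho x (iter i Gam v).
  by elim: i => //= i ->; rewrite Gcomm.
pose delta' x := delta x - rho x m.
have [||||m' _ m'E] := @cocycle_restrict V rho (lker (G j)) delta' _ rep.
- by move=> rho' d' rep' coc'; apply: IH rep' coc'; rewrite dimvf; apply: leq_trans Vn; exact: properU.
- by move=> x v; rewrite !memv_ker !GE iter_rho => /eqP->; rewrite linear0.
- split=> [a x y|x y]; rewrite /delta'.
    by rewrite dL rhoL add_lfunE scale_lfunE opprD addrACA scalerBr.
  by rewrite dM rho_lie !linearB addrACA.
- move=> x; apply: kerE; rewrite iterSr linearB /= -Gcomm -homotopy -linearB /=.
  by rewrite iter_rho -GE; move: mU; rewrite memv_ker => /eqP->; rewrite linear0.
by exists (m + m') => x; rewrite linearD /= -m'E addrC subrK.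
Qed.

End WhiteheadLemma.

Section Complement.
Variables (k : fieldType) (k0 : [pchar k] =i pred0) (S : vectLieType k).
Hypothesis ss : semisimple S.

Fact comm_linear (V : vectType k) (f : 'End(V)) :
  linear (fun g : 'End(V) => (f \o g)%VF - (g \o f)%VF).
Proof.
move=> a g h; rewrite comp_lfunDl comp_lfunDr -comp_lfunZl -comp_lfunZr scalerBr.
by rewrite opprD addrACA.
Qed.

Lemma comm_representation (V : vectType k) (rho : S -> 'End(V)) : representation rho ->
  representation (fun x => linmap (comm_linear (rho x))).
Proof.
move=> [rhoL rhoM]; split=> [a x y|x y]; apply/lfunP => g.
  rewrite add_lfunE scale_lfunE !linmapE rhoL comp_lfunDl comp_lfunDr.
  by rewrite -comp_lfunZl -comp_lfunZr scalerBr opprD addrACA.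
rewrite add_lfunE opp_lfunE !comp_lfunE !linmapE; apply/lfunP => v.
rewrite rhoM !(add_lfunE, opp_lfunE, comp_lfunE) /=.
rewrite !opprB [g (_ - _)]linearB [rho x (_ - _)]linearB [rho y (_ - _)]linearB /= !opprB.
rewrite [in RHS]addrACA !subrKA addrACA [RHS]addrACA.
by congr (_ + _); rewrite addrC.
Qed.

(* The coboundary of a projection p onto W is a cocycle with values in the maps
   V -> W vanishing on W; if it is also the coboundary of such a map g, then
   p - g is an equivariant projection onto W. *)
Theorem stable_complement (V : vectType k) (rho : S -> 'End(V)) (W : {vspace V}) :
  representation rho -> stable rho (mem W) ->
  exists C : {vspace V}, [/\ stable rho (mem C), (C :&: W = 0)%VS & (C + W = fullv)%VS].
Proof.
move=> rep rhoW; pose p := projv W.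
have pL : linear (fun f : 'End(V) => (p \o f - f)%VF).
  by move=> a f g; rewrite comp_lfunDr -comp_lfunZr scalerBr opprD addrACA.
have qL : linear (fun f : 'End(V) => (f \o p)%VF).
  by move=> a f g; rewrite comp_lfunDl -comp_lfunZl.
(* The condition [p \o f = f] puts the values of [f] in [W], and [f \o p = 0] makes [f] vanish on
   [W]. *)
pose M := (lker (linmap pL) :&: lker (linmap qL))%VS.
have memM f : f \in M <-> (forall v, f v \in W) /\ (forall w, w \in W -> f w = 0).
  rewrite memv_cap !memv_ker !linmapE; split=> [/andP[/eqP/lfunP fW /eqP/lfunP f0]|[fW f0]].
    split=> [v|w wW]; last by have := f0 w; rewrite comp_lfunE projv_id // zero_lfunE.
    have := fW v; rewrite add_lfunE opp_lfunE comp_lfunE zero_lfunE => /eqP.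
    by rewrite subr_eq0 => /eqP <-; exact: memv_proj.
  apply/andP; split; apply/eqP/lfunP => v; rewrite zero_lfunE.
    by rewrite add_lfunE opp_lfunE comp_lfunE projv_id // subrr.
  by rewrite comp_lfunE f0 // memv_proj.
pose ad x := linmap (comm_linear (rho x)).
have adE x f v : ad x f v = rho x (f v) - f (rho x v).
  by rewrite linmapE add_lfunE opp_lfunE !comp_lfunE.
have [||||g gM gE] := @cocycle_restrict k S _ ad M (fun x => ad x p) _ (comm_representation rep).
- by move=> rho' d' rep' coc'; exact: whitehead coc'.
- move=> x f /memM[fW f0]; apply/memM; split=> [v|w wW]; rewrite adE.
    by rewrite memvB ?rhoW ?fW.
  by rewrite !f0 ?rhoW // linear0 subrr.
- have [adL adM] := comm_representation rep.
  split=> [a x y|x y]; first by rewrite /ad adL add_lfunE scale_lfunE.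
  by rewrite [ad _]adM add_lfunE opp_lfunE !comp_lfunE.
- move=> x; apply/memM; split=> [v|w wW]; rewrite adE.
    by rewrite memvB ?rhoW ?memv_proj.
  by rewrite !projv_id ?subrr ?rhoW.
have [gW g0] := (memM g).1 gM; pose e := p - g.
have eE v : e v = p v - g v by rewrite add_lfunE opp_lfunE.
have eW v : e v \in W by rewrite eE memvB ?memv_proj.
have e_id w : w \in W -> e w = w by move=> wW; rewrite eE g0 // projv_id // subr0.
have ecomm x v : e (rho x v) = rho x (e v).
  have /lfunP/(_ v) := gE x; rewrite !adE => H.
  rewrite !eE linearB /= -[rho x (p v)](subrK (p (rho x v))) H.
  by rewrite [_ - _ + p _]addrC -[RHS]addrA addrAC subrr add0r.
exists (lker e); split=> [x v||].
- by rewrite !memv_ker ecomm => /eqP->; rewrite linear0.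
- apply/eqP; rewrite -subv0; apply/subvP => v; rewrite memv_cap memv_ker => /andP[/eqP ev vW].
  by rewrite memv0 -(e_id v vW) ev.
- apply/eqP; rewrite eqEsubv subvf; apply/subvP => v _.
  rewrite -[v](subrK (e v)); apply: memv_add => //.
  by rewrite memv_ker linearB /= (e_id (e v)) // subrr.
Qed.

End Complement.

(** * Lower central series and free nilpotent Lie algebras *)

Section LowerCentralSeries.
Variables (k : fieldType).
Implicit Types (L N : vectLieType k).

Lemma liev_ind L (U V : {vspace L}) (P : L -> Prop) :
  P 0 -> (forall x y, P x -> P y -> P (x + y)) -> (forall a x, P x -> P (a *: x)) ->
  (forall x y, x \in U -> y \in V -> P (lie x y)) ->
  forall z, z \in liev U V -> P z.
Proof.
move=> P0 PD PZ Plie z; pose X := [seq lie u v | u <- vbasis U, v <- vbasis V].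
rewrite -[liev U V]/<<X>>%VS => zX.
rewrite (@coord_span _ _ _ (in_tuple X) z zX).
elim/big_ind: _ => // i _; apply: PZ.
have /allpairsP[[u v] /= [uU vV ->]] : X`_i \in X by rewrite mem_nth.
by apply: Plie; exact: vbasis_mem.
Qed.

Lemma lcsS N j : lcs N j.+2 = liev fullv (lcs N j.+1).
Proof. by []. Qed.

Lemma lcs_dec N j : (lcs N j.+1 <= lcs N j)%VS.
Proof.
(* The index is truncated, so [lcs N 0] and [lcs N 1] coincide. *)
case: j => [|j]; first by [].
elim: j => [|j IH]; first exact: subvf.
by rewrite lcsS [lcs N j.+2]lcsS; apply: lievS.
Qed.

Lemma lcs_leq N i j : (i <= j)%N -> (lcs N j <= lcs N i)%VS.
Proof.
move=> /subnK <-; elim: (j - i)%N => // m IH.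
by rewrite addSn; apply: subv_trans IH; exact: lcs_dec.
Qed.

(** Induction on [i] for all [j]: Jacobi expresses [[[x, y], z]] by [[x, [y, z]]] and [[y, [x, z]]],
    and both inner and outer brackets with [y] fall under the hypothesis. *)
Lemma liev_lcs N i j : (liev (lcs N i.+1) (lcs N j.+1) <= lcs N (i.+1 + j.+1))%VS.
Proof.
elim: i j => [|i IH] j; first by rewrite add1n lcsS.
rewrite lcsS; apply: lievP => x z; move: x; apply: liev_ind.
- by rewrite lie0l mem0v.
- by move=> x y Px Py /[dup] /Px xz /Py yz; rewrite lieDl memvD.
- by move=> a x Px /Px xz; rewrite lieZl memvZ.
move=> x y _ yi zj; rewrite jacobi_lie; apply: memvB.
  rewrite -[lcs _ _]/(liev fullv (lcs N (i.+1 + j.+1))) memv_liev ?memvf //.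
  by rewrite (subvP (IH j)) ?memv_liev.
rewrite addSnnS; apply: (subvP (IH j.+1)); apply: memv_liev => //.
by rewrite lcsS memv_liev ?memvf.
Qed.

Lemma mem_lcs_lie N i j x y : x \in lcs N i.+1 -> y \in lcs N j.+1 ->
  lie x y \in lcs N (i.+1 + j.+1).
Proof. by move=> xi yj; apply: (subvP (liev_lcs N i j)); exact: memv_liev. Qed.

Lemma derived_series_lcs N j : (derived_series (fullv : {vspace N}) j <= lcs N j.+1)%VS.
Proof.
elim: j => [|j IH]; first exact: subvf.
by rewrite /= lcsS; apply: lievS => //; exact: subvf.
Qed.

Lemma solvable_of_nilpotent N t : lcs N t.+1 = 0%VS -> solvable N.
Proof. by move=> N0; exists t; apply/eqP; rewrite -subv0 -N0 derived_series_lcs. Qed.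

Lemma limg_liev L N (f : 'Hom(L, N)) (U V : {vspace L}) :
  (forall x y, f (lie x y) = lie (f x) (f y)) ->
  (f @: liev U V)%VS = liev (f @: U) (f @: V).
Proof.
move=> fM; apply/eqP; rewrite eqEsubv; apply/andP; split.
  apply/subvP => _ /memv_imgP[z zUV ->]; move: z zUV; apply: liev_ind.
  - by rewrite linear0 mem0v.
  - by move=> x y; rewrite linearD; exact: memvD.
  - by move=> a x; rewrite linearZ; exact: memvZ.
  - by move=> x y xU yV; rewrite fM memv_liev ?memv_img.
apply: lievP => _ _ /memv_imgP[x xU ->] /memv_imgP[y yV ->].
by rewrite -fM memv_img ?memv_liev.
Qed.

Lemma limg_lcs L N (f : 'Hom(L, N)) j :
  (forall x y, f (lie x y) = lie (f x) (f y)) -> limg f = fullv ->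
  (f @: lcs L j)%VS = lcs N j.
Proof.
move=> fM fS; rewrite /lcs; elim: j.-1 => //= i IH.
by rewrite limg_liev // IH fS.
Qed.

(** Modulo [W] each term of the lower central series lies in the next one: after both factors of a
    bracket are split along [W], only a bracket of two elements of [W] fails to go deeper, and it
    stays in [W]. *)
Lemma nilpotent_generated N t (W : {vspace N}) : lcs N t.+1 = 0%VS ->
  (liev W W <= W)%VS -> (W + lcs N 2 = fullv)%VS -> W = fullv.
Proof.
move=> N0 WW WN.
have step j : (lcs N j.+1 <= W + lcs N j.+2)%VS.
  elim: j => [|j IH]; first by rewrite WN subvf.
  rewrite lcsS; apply: lievP => x y; rewrite -WN => /memv_addP[w wW [n nN ->]] yj.
  have /memv_addP[w' w'W [y' y'j yE]] := subvP IH y yj.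
  have -> : lie (w + n) y = lie w w' + (lie w y' + lie n y).
    by rewrite lieDl [in lie w y]yE lieDr addrA.
  apply: memv_add; first by apply: (subvP WW); exact: memv_liev.
  by apply: memvD; [rewrite lcsS memv_liev ?memvf|exact: mem_lcs_lie nN yj].
have all j : (fullv <= W + lcs N j.+1)%VS.
  elim: j => [|j IH]; first by rewrite addvf subvf.
  by rewrite (subv_trans IH) // subv_add addvSl step.
by apply/eqP; rewrite eqEsubv subvf; have := all t; rewrite N0 addv0.
Qed.

Lemma dim_vquot (V : vectType k) (U : {vspace V}) :
  \dim {: vquot U} = (\dim {:V} - \dim U)%N.
Proof.
pose I : submodClosed V := GRing.SubmodClosed.clone k V (pred_of_vspace U) _.
pose f : 'Hom(V, vquot U) := linmap (@lquot_proj_linear k V I).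
have kerf : lker f = U.
  apply/vspaceP => x; rewrite memv_ker linmapE; apply/eqP/idP => [/lquot_eq0//|xU].
  exact/lquot_eq0.
have imf : limg f = fullv.
  apply/vspaceP => y; rewrite memvf -(lquot_reprK y) -[lquot_proj _ _](linmapE (@lquot_proj_linear k V I)).
  by rewrite memv_img ?memvf.
by rewrite -(limg_ker_dim f fullv) capfv kerf imf addKn.
Qed.

Lemma lie_typeE N : lie_type N = (\dim {:N} - \dim (lcs N 2))%N.
Proof. exact: dim_vquot. Qed.

End LowerCentralSeries.

Section FreeLieUniversal.
Variables (k : fieldType) (d : nat) (L : lieType k) (g : 'I_d -> L).

Fixpoint lterm_eval (x : lterm k d) : L :=
  match x with
  | LGen i => g i
  | LZero => 0
  | LAdd x y => lterm_eval x + lterm_eval y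
  | LScale a x => a *: lterm_eval x
  | LLie x y => lie (lterm_eval x) (lterm_eval y)
  end.

Lemma lterm_eval_cong x y : lcong x y -> lterm_eval x = lterm_eval y.
Proof.
elim=> {x y} //=; try by move=> *; congruence.
- by move=> *; rewrite addrA.
- by move=> *; rewrite addrC.
- by move=> *; rewrite add0r.
- by move=> *; rewrite scaleN1r addNr.
- by move=> *; rewrite scalerA.
- by move=> *; rewrite scale1r.
- by move=> *; rewrite scalerDr.
- by move=> *; rewrite scalerDl.
- by move=> *; rewrite lieDl.
- by move=> *; rewrite lieDr.
- by move=> *; rewrite lieZl.
- by move=> *; rewrite lieZr.
- by move=> *; rewrite liexx.
- by move=> *; rewrite lie_jacobi.
Qed.

Definition freelie_eval (x : freelie k d) : L := lterm_eval (fl_repr x).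

Lemma freelie_evalE x : freelie_eval (fl_proj x) = lterm_eval x.
Proof. by apply: lterm_eval_cong; exact: fl_reprP. Qed.

Fact freelie_eval_linear : linear freelie_eval.
Proof.
move=> a; elim/fl_ind=> x; elim/fl_ind=> y.
by rewrite [a *: _]fl_scaleE [_ + fl_proj y]fl_addE !freelie_evalE.
Qed.
HB.instance Definition _ :=
  GRing.isLinear.Build k (freelie k d) L _ freelie_eval freelie_eval_linear.

Lemma freelie_eval_lie x y : freelie_eval (lie x y) = lie (freelie_eval x) (freelie_eval y).
Proof.
by elim/fl_ind: x => x; elim/fl_ind: y => y; rewrite [lie _ _ in LHS]fl_lieE !freelie_evalE.
Qed.

Lemma freelie_eval_gen i : freelie_eval (fl_gen k i) = g i.
Proof. exact: freelie_evalE. Qed.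

End FreeLieUniversal.

Section FreeNilpotentUniversal.
Variables (k : fieldType) (d t : nat).
Local Notation FN := (freenil k d t).

Lemma freelie_eval_lcs (N : vectLieType k) (g : 'I_d -> N) n x :
  fl_deg_ge n x -> freelie_eval g x \in lcs N n.
Proof.
have homogP m y : homog m y -> freelie_eval g y \in lcs N m.
  elim=> {m y} [i|m|m y z _ Hy _ Hz|m a y _ Hy|m m' y z hy Hy hz Hz].
  - exact: memvf.
  - by rewrite linear0 mem0v.
  - by rewrite linearD memvD.
  - by rewrite linearZ memvZ.
  (* Homogeneous elements of degree 0 are zero, so both degrees may be taken positive, as in
     [mem_lcs_lie]. *)
  case: (homog_gt0 hy) => [->|]; first by rewrite lie0l linear0 mem0v.
  case: (homog_gt0 hz) => [->|]; first by rewrite lie0r linear0 mem0v.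
  rewrite freelie_eval_lie; case: m' Hz {hz} => // m' Hz _; case: m Hy {hy} => // m Hy _.
  exact: mem_lcs_lie.
elim=> {x} [m x nm /homogP|x y _ Hx _ Hy|a x _ Hx].
- exact/subvP/lcs_leq.
- by rewrite linearD memvD.
- by rewrite linearZ memvZ.
Qed.

Lemma freenil_ind (P : FN -> Prop) : (forall i, P (fn_gen k t i)) -> P 0 ->
  (forall x y, P x -> P y -> P (x + y)) -> (forall a x, P x -> P (a *: x)) ->
  (forall x y, P x -> P y -> P (lie x y)) -> forall x, P x.
Proof.
move=> Pg P0 PD PZ PL x; rewrite -(liequot_reprK x).
elim/freelie_ind: (liequot_repr x) => {x} [||x y Px Py|a x Px|x y Px Py].
- exact: Pg.
- by rewrite linear0.
- by rewrite linearD; exact: PD.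
- by rewrite linearZ; exact: PZ.
- by rewrite liequot_proj_lie; exact: PL.
Qed.

(** Evaluation sends elements of degree above [t] into [lcs N t.+1 = 0], so it factors through the
    quotient. *)
Lemma freenil_universal (N : vectLieType k) (g : 'I_d -> N) : lcs N t.+1 = 0%VS ->
  exists F : 'Hom(FN, N), (forall x y, F (lie x y) = lie (F x) (F y)) /\
    forall i, F (fn_gen k t i) = g i.
Proof.
move=> N0; pose f (x : FN) := freelie_eval g (liequot_repr x).
have fE x : f (fn_proj t x) = freelie_eval g x.
  apply/eqP; rewrite -subr_eq0 -linearB -memv0 -N0; apply: freelie_eval_lcs; apply/asboolP.
  by apply/(@lquot_eq k _ (fl_ideal k d t.+1)); exact: (lquot_reprK (fn_proj t x)).
have fL : linear f.
  move=> a x y; rewrite -{1}(liequot_reprK x) -{1}(liequot_reprK y).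
  by rewrite -[X in f X]linearP fE linearP.
exists (linmap fL); split=> [x y|i]; rewrite !linmapE.
  rewrite -{1}(liequot_reprK x) -{1}(liequot_reprK y) -[X in f X]liequot_proj_lie fE.
  exact: freelie_eval_lie.
by rewrite [LHS]fE freelie_eval_gen.
Qed.

(** Elements of the [j.+1]-st term lift to elements of degree at least [j.+1] in the free Lie
    algebra. *)
Lemma freenil_nilpotent : lcs FN t.+1 = 0%VS.
Proof.
have lcsP j x : x \in lcs FN j.+1 -> exists2 u, fl_deg_ge j.+1 u & x = fn_proj t u.
  elim: j x => [|j IH] x.
    by move=> _; exists (liequot_repr x); [exact: fl_deg_ge1|rewrite [RHS]liequot_reprK].
  rewrite lcsS; apply: (liev_ind (P := fun x => exists2 u, fl_deg_ge j.+2 u & x = fn_proj t u)).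
  - by exists 0; [exact: fl_deg_ge0|rewrite [RHS]linear0].
  - move=> _ _ [u hu ->] [v hv ->]; exists (u + v); first exact: fl_deg_geD.
    by rewrite [RHS]linearD.
  - move=> a _ [u hu ->]; exists (a *: u); first exact: fl_deg_geZ.
    by rewrite [RHS]linearZ.
  - move=> y _ _ /IH[v hv ->]; exists (lie (liequot_repr y) v).
      exact: (fl_deg_ge_lie (fl_deg_ge1 _) hv).
    by rewrite [RHS]liequot_proj_lie liequot_reprK.
apply/eqP; rewrite -subv0; apply/subvP => x /lcsP[u hu ->].
by rewrite memv0; apply/eqP/liequot_eq0/asboolP.
Qed.

Lemma freenil_decomposition x : exists (c : 'I_d -> k) (z : FN),
  z \in lcs FN 2 /\ x = \sum_i c i *: fn_gen k t i + z.
Proof.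
elim/freenil_ind: x => [i||_ _ [c [z [zN ->]]] [c' [z' [zN' ->]]]|a _ [c [z [zN ->]]]|x y _ _].
- exists (fun j => (j == i)%:R), 0; split; first exact: mem0v.
  rewrite addr0 (bigD1 i) //= eqxx scale1r big1 ?addr0 // => j /negPf->.
  exact: scale0r.
- by exists (fun=> 0), 0; rewrite mem0v addr0 big1 // => i _; rewrite scale0r.
- exists (fun i => c i + c' i), (z + z'); rewrite memvD // addrACA -big_split /=.
  by split=> //; congr (_ + _); apply: eq_bigr => i _; rewrite scalerDl.
- exists (fun i => a * c i), (a *: z); rewrite memvZ // scalerDr scaler_sumr.
  by split=> //; congr (_ + _); apply: eq_bigr => i _; rewrite scalerA.
- exists (fun=> 0), (lie x y); rewrite big1 ?add0r => [|i _]; last exact: scale0r.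
  by split=> //; rewrite lcsS memv_liev ?memvf.
Qed.

End FreeNilpotentUniversal.

Section Abelianization.
Variables (k : fieldType) (V : vectType k).

(** A copy of [V] that carries the zero bracket; as a target of the universal property it detects
    generators modulo the derived algebra. *)
Definition abelian_lie : Type := V.
HB.instance Definition _ := Vector.on abelian_lie.

Definition abelian_bracket (x y : abelian_lie) : abelian_lie := 0.

Fact abelian_lieDl x y z :
  abelian_bracket (x + y) z = abelian_bracket x z + abelian_bracket y z.
Proof. by rewrite addr0. Qed.
Fact abelian_lieDr x y z :
  abelian_bracket x (y + z) = abelian_bracket x y + abelian_bracket x z.
Proof. by rewrite addr0. Qed.
Fact abelian_lieZl a x y : abelian_bracket (a *: x) y = a *: abelian_bracket x y.
Proof. by rewrite scaler0. Qed.
Fact abelian_lieZr a x y : abelian_bracket x (a *: y) = a *: abelian_bracket x y.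
Proof. by rewrite scaler0. Qed.
Fact abelian_liexx x : abelian_bracket x x = 0.
Proof. by []. Qed.
Fact abelian_jacobi x y z : abelian_bracket x (abelian_bracket y z)
  + abelian_bracket y (abelian_bracket z x) + abelian_bracket z (abelian_bracket x y) = 0.
Proof. by rewrite /abelian_bracket !addr0. Qed.

HB.instance Definition _ := Lmodule_isLie.Build k abelian_lie abelian_lieDl abelian_lieDr
  abelian_lieZl abelian_lieZr abelian_liexx abelian_jacobi.

Lemma lcs_abelian t : (0 < t)%N -> lcs (abelian_lie : vectLieType k) t.+1 = 0%VS.
Proof.
case: t => // t _; apply/eqP; rewrite -subv0 lcsS; apply: lievP => x y _ _.
exact: mem0v.
Qed.

End Abelianization.

(** The generators are sent to the unit rows of an abelian Lie algebra, whose term of index [t.+1]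
    is 0 because [0 < t]. So they are independent modulo the second term. *)
Lemma freenil_abelianization (k : fieldType) (d t : nat) : (0 < t)%N ->
  exists eps : 'Hom(freenil k d t, 'rV[k]_d),
    (forall c : 'I_d -> k, eps (\sum_i c i *: fn_gen k t i) = \row_i c i) /\
    lker eps = lcs (freenil k d t) 2.
Proof.
move=> t0; pose A := abelian_lie 'rV[k]_d : vectLieType k.
have [eps [epsM epsg]] := @freenil_universal k d t A (fun i => delta_mx 0 i) (lcs_abelian _ t0).
have epsE c : eps (\sum_i c i *: fn_gen k t i) = \row_i c i.
  rewrite linear_sum [RHS]row_sum_delta; apply: eq_bigr => i _.
  by rewrite linearZ /= epsg mxE.
exists eps; split=> //.
have sub : (lcs (freenil k d t) 2 <= lker eps)%VS.
  by rewrite lcsS; apply: lievP => x y _ _; rewrite memv_ker epsM.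
apply/eqP; rewrite eqEsubv sub andbT; apply/subvP => x.
have [c [z [zN ->]]] := freenil_decomposition x.
move/subvP/(_ z zN): sub; rewrite !memv_ker linearD /= => /eqP->.
rewrite addr0 epsE => /eqP/rowP c0; rewrite big1 ?add0r // => i _.
by have := c0 i; rewrite !mxE => ->; rewrite scale0r.
Qed.

(** * Derivations and the representation [Delta t X \o rho] *)

Section DerivationAlgebra.
Variables (k : fieldType) (L : vectLieType k).

Lemma derivation_linear a (D D' : 'End(L)) :
  derivation D -> derivation D' -> derivation (a *: D + D').
Proof.
move=> dD dD' x y; rewrite !add_lfunE !scale_lfunE dD dD'.
by rewrite lieDl lieDr lieZl lieZr scalerDr addrACA.
Qed.

Lemma derivation_comm (D D' : 'End(L)) : derivation D -> derivation D' ->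
  derivation ((D \o D')%VF - (D' \o D)%VF).
Proof.
move=> dD dD' x y; rewrite !add_lfunE !opp_lfunE !comp_lfunE dD dD' !linearD /= !dD !dD'.
rewrite lieBl lieBr; move: (lie (D x) (D' y)) (lie (D' x) (D y)) => u v.
by rewrite !opprD !addrA [LHS](ACl (1*5*4*8*(2*7)*(3*6)))%AC /= !subrr !addr0.
Qed.

End DerivationAlgebra.

Section DeltaRepresentation.
Variables (k : fieldType) (d t : nat) (S : vectLieType k) (m : vectType k).
Variables (rho : S -> 'End(m)) (X : d.-tuple m).
Hypotheses (rep : representation rho) (basX : basis_of fullv X).
Local Notation FN := (freenil k d t).

Lemma Delta_derivation f : derivation (Delta t X f).
Proof. by have [] := der_extP (fn_inj t X \o f)%VF basX. Qed.

Lemma Delta_inj f v : Delta t X f (fn_inj t X v) = fn_inj t X (f v).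
Proof. by have [_ ->] := der_extP (fn_inj t X \o f)%VF basX; rewrite comp_lfunE. Qed.

Lemma fn_inj_coord v : fn_inj t X v = \sum_i coord X i v *: fn_gen k t i.
Proof.
rewrite {1}(coord_basis basX (memvf v)) linear_sum; apply: eq_bigr => i _.
by rewrite linearZ /= fn_injE.
Qed.

Lemma fn_gen_inj i : fn_gen k t i = fn_inj t X X`_i.
Proof. by rewrite fn_injE. Qed.

(** The two sides of each identity are derivations, so they need only agree on the generators, where
    [Delta] acts as [rho]. *)
Lemma Delta_representation : representation (Delta t X \o rho).
Proof.
have [rhoL rhoM] := rep.
split=> [a x y|x y] /=; apply: der_unique => [||i]; try exact: Delta_derivation.
- by apply: derivation_linear; exact: Delta_derivation.
- by rewrite fn_gen_inj add_lfunE scale_lfunE !Delta_inj rhoL add_lfunE scale_lfunE linearP.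
- by apply: derivation_comm; exact: Delta_derivation.
- by rewrite fn_gen_inj add_lfunE opp_lfunE !comp_lfunE !Delta_inj rhoM add_lfunE opp_lfunE
    !comp_lfunE linearB.
Qed.

Lemma fn_inj_lcs v : (0 < t)%N -> fn_inj t X v \in lcs FN 2 -> v = 0.
Proof.
move=> t0; have [eps [epsE <-]] := freenil_abelianization k d t0.
rewrite memv_ker fn_inj_coord epsE => /eqP/rowP c0.
rewrite (coord_basis basX (memvf v)) big1 // => i _.
by have := c0 i; rewrite !mxE => ->; rewrite scale0r.
Qed.

End DeltaRepresentation.

Lemma codim_lcs2_freenil (k : fieldType) (d t : nat) : (0 < t)%N ->
  (\dim {: freenil k d t} - \dim (lcs (freenil k d t) 2))%N = d.
Proof.
move=> t0; have [eps [epsE <-]] := freenil_abelianization k d t0.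
have imeps : limg eps = fullv.
  apply/vspaceP => r; rewrite memvf; apply/memv_imgP.
  exists (\sum_i r 0 i *: fn_gen k t i); rewrite ?memvf //.
  by rewrite epsE; apply/rowP => i; rewrite mxE.
by rewrite -(limg_ker_dim eps fullv) capfv imeps addKn dimvf /dim /= mul1n.
Qed.

(** * Quotients by stable ideals and their Levi extensions *)

Section LieQuotientSpace.
Variables (k : fieldType) (L : vectLieType k) (I : lieIdeal L).
Local Notation Q := (liequot I : vectLieType k).

Fact liequot_proj_linear : linear (liequot_proj I : L -> Q).
Proof. exact: linearP. Qed.

Definition liequot_hom : 'Hom(L, Q) := linmap liequot_proj_linear.

Lemma liequot_homE x : liequot_hom x = liequot_proj I x.
Proof. exact: linmapE. Qed.

Lemma liequot_hom_lie x y : liequot_hom (lie x y) = lie (liequot_hom x) (liequot_hom y).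
Proof. by rewrite !liequot_homE liequot_proj_lie. Qed.

Lemma liequot_hom_surj : limg liequot_hom = fullv.
Proof.
apply/vspaceP => y; rewrite memvf -(liequot_reprK y) -liequot_homE.
by rewrite memv_img ?memvf.
Qed.

Lemma memv_liequot_ker x : (x \in lker liequot_hom) = (x \in I).
Proof. by rewrite memv_ker liequot_homE; apply/eqP/idP => /liequot_eq0. Qed.

Lemma quot_module_representation (S : vectLieType k) (tau : S -> 'End(L)) :
  representation tau -> stable tau I -> representation (quot_module I tau).
Proof.
move=> [tL tM] tI; have E s x := quot_endE (tI s) x.
split=> [a x y|x y]; apply/lfunP; elim/liequot_ind=> u.
  by rewrite add_lfunE scale_lfunE !E tL add_lfunE scale_lfunE linearP.
rewrite add_lfunE opp_lfunE !comp_lfunE !E tM add_lfunE opp_lfunE !comp_lfunE.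
exact: linearB.
Qed.

Lemma quot_module_derivation (S : vectLieType k) (tau : S -> 'End(L)) s :
  stable tau I -> derivation (tau s) -> derivation (quot_module I tau s : 'End(Q)).
Proof.
move=> tI dt; have E x := quot_endE (tI s) x.
elim/liequot_ind=> u; elim/liequot_ind=> v.
rewrite -liequot_proj_lie !E dt -!liequot_proj_lie; exact: linearD.
Qed.

End LieQuotientSpace.

Section LeviQuotient.
Variables (k : fieldType) (S : vectLieType k) (S_semisimple : semisimple S).
Variables (d t : nat) (t_gt0 : (0 < t)%N).
Variables (m : vectType k) (rho : S -> 'End(m)) (X : d.-tuple m).
Variable I : lieIdeal (freenil k d t).
Hypotheses (rep : representation rho) (basX : basis_of fullv X).
Hypothesis stabI : stable (Delta t X \o rho) I.
Hypothesis lcsI : ~ {subset lcs (freenil k d t) t <= I}.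
Hypothesis Ilcs : {subset I <= lcs (freenil k d t) 2}.
Local Notation FN := (freenil k d t).
Local Notation Q := (liequot I : vectLieType k).

Let pr_lcs j : (liequot_hom I @: lcs FN j)%VS = lcs Q j.
Proof. exact: limg_lcs (@liequot_hom_lie _ _ I) (liequot_hom_surj I). Qed.

Lemma levi_quotient_nilpotent : nilpotent_class t Q.
Proof.
split; last by rewrite -pr_lcs freenil_nilpotent limg0.
apply/negP => /eqP Q0; apply: lcsI => x xt; rewrite -memv_liequot_ker memv_ker -memv0 -Q0.
by rewrite -pr_lcs memv_img.
Qed.

(** As the kernel [I] lies in the second term, this term keeps its codimension in the quotient. *)
Lemma levi_quotient_type : lie_type Q = d.
Proof.
rewrite lie_typeE -pr_lcs -[RHS](codim_lcs2_freenil k d t_gt0).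
have kerI : (lker (liequot_hom I) <= lcs FN 2)%VS.
  by apply/subvP => x; rewrite memv_liequot_ker; exact: Ilcs.
have := limg_ker_dim (liequot_hom I) fullv; rewrite capfv liequot_hom_surj => <-.
have := limg_ker_dim (liequot_hom I) (lcs FN 2); rewrite (capv_idPr kerI) => <-.
by rewrite subnDl.
Qed.

Lemma levi_quotient_extension : Levi_extension (quot_module I (Delta t X \o rho) : S -> 'End(Q)).
Proof.
split=> // [||s].
- exact: solvable_of_nilpotent (proj2 levi_quotient_nilpotent).
- exact: quot_module_representation (Delta_representation t rep basX) stabI.
- apply: quot_module_derivation; first exact: stabI. by apply: Delta_derivation.
Qed.

(** Since [I] lies in the second term, which meets [m] in 0, [m] embeds into the quotient. So the
    action on the quotient determines [rho s], which in turn determines the derivation. *)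
Lemma levi_quotient_faithful :
  faithful (quot_module I (Delta t X \o rho)) <-> faithful rho.
Proof.
split=> inj s s' ss'; apply: inj; first by rewrite /quot_module /= ss'.
apply/lfunP => v; apply/eqP; rewrite -subr_eq0; apply/eqP.
apply: (fn_inj_lcs basX t_gt0); apply: Ilcs; rewrite linearB /= -!Delta_inj //.
apply/(@lquot_eq k _ I); move/lfunP: ss' => /(_ (liequot_proj I (fn_inj t X v))).
by rewrite !(quot_endE (stabI _)).
Qed.

End LeviQuotient.

(** * Transport along isomorphisms of Lie algebras *)

Section Transport.
Variables (k : fieldType) (S N Q : vectLieType k).
Variables (phi : Q -> N) (phiP : lie_iso phi).

Let phiL : linear phi. Proof. by case: phiP. Qed.
Let f : 'Hom(Q, N) := linmap phiL.

Let fM x y : f (lie x y) = lie (f x) (f y).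
Proof. by rewrite !linmapE; case: phiP. Qed.

Let f_inj : lker f == 0%VS.
Proof.
by apply/lker0P => x y; rewrite !linmapE; case: phiP => _ _ /bij_inj; apply.
Qed.

Let f_surj y : exists x, y = f x.
Proof.
case: phiP => _ _ [g _ gK]; exists (g y); by rewrite linmapE gK.
Qed.

Let f_lcs j : (f @: lcs Q j)%VS = lcs N j.
Proof.
apply: limg_lcs fM _; apply/vspaceP => y; rewrite memvf.
by have [x ->] := f_surj y; rewrite memv_img ?memvf.
Qed.

Let f_dim (U : {vspace Q}) : \dim (f @: U) = \dim U.
Proof. by apply: limg_dim_eq; rewrite (eqP f_inj) capv0. Qed.

Lemma iso_nilpotent_class t : nilpotent_class t Q -> nilpotent_class t N.
Proof.
move=> [Qt Qt1]; split; last by rewrite -f_lcs Qt1 limg0.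
by rewrite -dimv_eq0 -f_lcs f_dim dimv_eq0.
Qed.

Lemma iso_lie_type : lie_type N = lie_type Q.
Proof.
have : \dim {:N} = \dim {:Q} by rewrite -(f_dim fullv); congr (\dim _); exact/esym/(f_lcs 1).
by move=> dE; rewrite !lie_typeE -(f_lcs 2) f_dim dE.
Qed.

Lemma iso_Levi_extension t (tau : S -> 'End(Q)) (sigma : S -> 'End(N)) :
  nilpotent_class t Q -> Levi_extension tau ->
  (forall s x, phi (tau s x) = sigma s (phi x)) -> Levi_extension sigma.
Proof.
move=> Qt [ss _ [tauL tauM] tauD] eqv.
have sE s x : sigma s (f x) = f (tau s x) by rewrite !linmapE eqv.
split=> // [||s x y].
- exact: solvable_of_nilpotent (proj2 (iso_nilpotent_class Qt)).
- split=> [a x y|x y]; apply/lfunP => z; have [{}z ->] := f_surj z.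
    by rewrite add_lfunE scale_lfunE !sE tauL add_lfunE scale_lfunE linearP.
  by rewrite add_lfunE opp_lfunE !comp_lfunE !sE tauM add_lfunE opp_lfunE !comp_lfunE linearB.
- have [{}x ->] := f_surj x; have [{}y ->] := f_surj y.
  by rewrite -fM !sE tauD linearD /= !fM.
Qed.

End Transport.

(** * Kernels of morphisms and the presentation of a Levi-extended algebra *)

Section LieKernel.
Variables (k : fieldType) (L N : vectLieType k) (F : 'Hom(L, N)).
Hypothesis FM : forall x y, F (lie x y) = lie (F x) (F y).

Definition lie_ker : pred L := fun x => F x == 0.

Fact lie_ker_submod_closed : submod_closed lie_ker.
Proof.
split=> [|a x y]; rewrite !unfold_in /lie_ker ?linear0 // => /eqP x0 /eqP y0.
by rewrite linearP /= x0 y0 scaler0 addr0.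
Qed.

Fact lie_ker_ideal : lie_ideal_closed lie_ker.
Proof.
by move=> x y; rewrite !unfold_in /lie_ker FM => /eqP->; rewrite lie0r.
Qed.

Definition lie_kernel : lieIdeal L := HB.pack_for (lieIdeal L) lie_ker
  (GRing.isSubmodClosed.Build k L lie_ker lie_ker_submod_closed)
  (isLieIdeal.Build k L lie_ker lie_ker_ideal).

Lemma mem_lie_kernel x : (x \in lie_kernel) = (F x == 0).
Proof. by []. Qed.

Definition lie_kernel_map (x : liequot lie_kernel) : N := F (liequot_repr x).

Lemma lie_kernel_mapE x : lie_kernel_map (liequot_proj lie_kernel x) = F x.
Proof.
apply/eqP; rewrite -subr_eq0 -linearB -mem_lie_kernel; apply/(@lquot_eq k _ lie_kernel).
exact: (lquot_reprK (liequot_proj lie_kernel x)).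
Qed.

Lemma lie_kernel_map_iso : limg F = fullv ->
  lie_iso (lie_kernel_map : (liequot lie_kernel : vectLieType k) -> N).
Proof.
move=> FS; have mL : linear lie_kernel_map.
  move=> a; elim/liequot_ind=> x; elim/liequot_ind=> y.
  by rewrite -[X in lie_kernel_map X]linearP !lie_kernel_mapE linearP.
split=> //.
  elim/liequot_ind=> x; elim/liequot_ind=> y.
  by rewrite -liequot_proj_lie !lie_kernel_mapE FM.
have FV y : F (F^-1 y)%VF = y by rewrite limg_lfunVK // FS memvf.
exists (fun y => liequot_proj lie_kernel (F^-1 y)%VF) => [|y].
  elim/liequot_ind=> x; rewrite lie_kernel_mapE; apply/(@lquot_eq k _ lie_kernel).
  by rewrite mem_lie_kernel linearB /= FV subrr.
by rewrite lie_kernel_mapE FV.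
Qed.

End LieKernel.

Section LeviPresentation.
Variables (k : fieldType) (k_char0 : [pchar k] =i pred0) (S N : vectLieType k).
Variables (d t : nat) (t_gt0 : (0 < t)%N) (sigma : S -> 'End(N)).

Lemma derivation_stable_lcs2 (D : 'End(N)) : derivation D ->
  forall x, x \in lcs N 2 -> D x \in lcs N 2.
Proof.
move=> dD; rewrite lcsS; apply: liev_ind.
- by rewrite linear0 mem0v.
- by move=> x y; rewrite linearD; exact: memvD.
- by move=> a x; rewrite linearZ; exact: memvZ.
- by move=> x y _ _; rewrite dD memvD // memv_liev ?memvf.
Qed.

Lemma levi_presentation :
  nilpotent_class t N -> lie_type N = d -> Levi_extension sigma ->
  exists (m : vectType k) (rho : S -> 'End(m)) (X : d.-tuple m)
         (I : lieIdeal (freenil k d t)) (phi : liequot I -> N),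
    [/\ representation rho, basis_of fullv X, stable (Delta t X \o rho) I,
        ~ {subset lcs (freenil k d t) t <= I} /\ {subset I <= lcs (freenil k d t) 2}
      & lie_iso phi /\
        forall s x, phi (quot_module I (Delta t X \o rho) s x) = sigma s (phi x)].
Proof.
move=> [Nt Nt1] Nd [ss _ rep der]; have [sL sM] := rep.
have [C [Cst CN2 CN]] := @stable_complement k k_char0 S ss N sigma (lcs N 2) rep
  (fun s => derivation_stable_lcs2 (der s)).
have Cd : \dim C = d.
  by rewrite -Nd lie_typeE -CN dimv_disjoint_sum // addnK.
pose m : vectType k := subvs_of C.
have rL s : linear (fun u : subvs_of C => vsproj C (sigma s (vsval u))).
  by move=> a u v; rewrite !linearP.
pose rho s : 'End(m) := linmap (rL s).
have rE s u : vsval (rho s u) = sigma s (vsval u).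
  by rewrite linmapE vsprojK // Cst // subvsP.
have rho_rep : representation rho.
  split=> [a x y|x y]; apply/lfunP => u; apply: subvs_inj.
    by rewrite rE sL !add_lfunE !scale_lfunE linearP /= !rE.
  by rewrite rE sM !add_lfunE !opp_lfunE !comp_lfunE linearB /= !rE.
have [X basX] : exists X : d.-tuple m, basis_of fullv X.
  have <- : \dim {:m} = d by rewrite dimvf.
  by exists (vbasis fullv); exact: vbasisP.
have [F [FM Fgen]] := freenil_universal (fun i : 'I_d => vsval X`_i) Nt1.
have Finj v : F (fn_inj t X v) = vsval v.
  rewrite (fn_inj_coord t basX) {2}(coord_basis basX (memvf v)) !linear_sum.
  by apply: eq_bigr => i _; rewrite !linearZ /= Fgen.
(* The image is a subalgebra containing [C], so together with [lcs N 2] it spans [N]. *)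
have FS : limg F = fullv.
  apply: nilpotent_generated Nt1 _ _.
    apply: lievP => _ _ /memv_imgP[x _ ->] /memv_imgP[y _ ->].
    by rewrite -FM memv_img ?memvf.
  apply/eqP; rewrite eqEsubv subvf -CN addvS //; apply/subvP => v vC.
  by rewrite -(vsprojK vC) -Finj memv_img ?memvf.
(* Both sides obey the same Leibniz rule along [F], so agreement on the generators propagates. *)
have Feqv s x : F (Delta t X (rho s) x) = sigma s (F x).
  have dD := Delta_derivation (t := t) basX (rho s).
  elim/freenil_ind: x => [i||x y Hx Hy|a x Hx|x y Hx Hy].
  - by rewrite (fn_gen_inj t basX) Delta_inj // !Finj rE.
  - by rewrite !linear0.
  - by rewrite !linearD /= Hx Hy.
  - by rewrite !linearZ /= Hx.
  - by rewrite dD linearD /= !FM Hx Hy der.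
have stabI : stable (Delta t X \o rho) (lie_kernel FM).
  by move=> s x; rewrite !mem_lie_kernel /= Feqv => /eqP->; rewrite linear0.
exists m, rho, X, (lie_kernel FM), (@lie_kernel_map k _ _ F FM); split=> //; split.
- move=> sub; case/negP: Nt; rewrite -(limg_lcs t FM FS) -lkerE; apply/subvP => x /sub.
  by rewrite mem_lie_kernel memv_ker.
(* Write [x] as the image of some [v] in [m] plus [z] in the second term. If [F x = 0], then [v]
   equals [- F z], which lies in the intersection of [C] and [lcs N 2], hence is 0. *)
- move=> x; rewrite mem_lie_kernel; have [c [z [z2 xE]]] := freenil_decomposition x.
  pose v := \sum_i c i *: X`_i.
  have vE : fn_inj t X v = \sum_i c i *: fn_gen k t i.
    by rewrite linear_sum; apply: eq_bigr => i _; rewrite linearZ /= fn_injE.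
  rewrite xE -vE linearD /= Finj addr_eq0 => /eqP vF.
  have Fz : F z \in lcs N 2 by rewrite -(limg_lcs 2 FM FS) memv_img.
  have : vsval v \in (C :&: lcs N 2)%VS by rewrite memv_cap subvsP vF memvN Fz.
  rewrite CN2 memv0 => /eqP v0; have -> : v = 0 by apply: subvs_inj; rewrite v0.
  by rewrite linear0 add0r.
- exact: lie_kernel_map_iso.
- move=> s; elim/liequot_ind=> x.
  by rewrite (quot_endE (stabI s)) !lie_kernel_mapE /= Feqv.
Qed.

End LeviPresentation.

Theorem theorem3p5 (k : fieldType) (k_char0 : [pchar k] =i pred0)
    (S : vectLieType k) (S_semisimple : semisimple S) (d t : nat) (t_gt0 : (0 < t)%N) :
  (forall (N : vectLieType k) (sigma : S -> 'End(N)),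
     [/\ nilpotent_class t N, lie_type N = d & Levi_extension sigma]
     <->
     exists (m : vectType k) (rho : S -> 'End(m)) (X : d.-tuple m)
            (I : lieIdeal (freenil k d t)) (phi : liequot I -> N),
       [/\ representation rho,
           basis_of fullv X,
           stable (Delta t X \o rho) I,
           ~ {subset lcs (freenil k d t) t <= I} /\
             {subset I <= lcs (freenil k d t) 2}
         & lie_iso phi /\
           forall s x, phi (quot_module I (Delta t X \o rho) s x) = sigma s (phi x)])
  /\
  (forall (m : vectType k) (rho : S -> 'End(m)) (X : d.-tuple m)
          (I : lieIdeal (freenil k d t)),
     representation rho ->
     basis_of fullv X ->
     stable (Delta t X \o rho) I ->
     ~ {subset lcs (freenil k d t) t <= I} ->
     {subset I <= lcs (freenil k d t) 2} ->
     [/\ nilpotent_class t (liequot I : vectLieType k),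
         lie_type (liequot I : vectLieType k) = d,
         Levi_extension (quot_module I (Delta t X \o rho))
       & (faithful (quot_module I (Delta t X \o rho)) <-> faithful rho)]).
Proof.
(* Proved first, because the converse half of the equivalence follows from it by transport along
   [phi]. *)
have part2 (m : vectType k) (rho : S -> 'End(m)) (X : d.-tuple m)
    (I : lieIdeal (freenil k d t)) (rep : representation rho) (basX : basis_of fullv X)
    (stabI : stable (Delta t X \o rho) I)
    (lcsI : ~ {subset lcs (freenil k d t) t <= I})
    (Ilcs : {subset I <= lcs (freenil k d t) 2}) :
    [/\ nilpotent_class t (liequot I : vectLieType k),
        lie_type (liequot I : vectLieType k) = d,
        Levi_extension (quot_module I (Delta t X \o rho))
      & (faithful (quot_module I (Delta t X \o rho)) <-> faithful rho)].
  split.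
  - exact: levi_quotient_nilpotent.
  - exact: levi_quotient_type.
  - exact: levi_quotient_extension.
  - exact: levi_quotient_faithful.
split=> // N sigma; split=> [[Nt Nd lev]|]; first exact: levi_presentation.
move=> [m [rho [X [I [phi [rep basX stabI [lcsI Ilcs] [phiP eqv]]]]]]].
have [Qt Qd lev _] := part2 m rho X I rep basX stabI lcsI Ilcs; split.
- exact: iso_nilpotent_class phiP _ Qt.
- by rewrite (iso_lie_type phiP).
- exact: iso_Levi_extension phiP _ _ _ Qt lev eqv.
Qed.
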